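(* Let $G$ be a group acting specially on a quasi-median graph $X$ with finitely many orbits of vertices. Then there exist a simplicial graph $\Gamma$ and a collection $\mathcal{G}$ of groups indexed by $V(\Gamma)$, each of which contains a finite-index subgroup isomorphic to $\mathrm{stab}_G(C)$ for some clique $C$ of $X$, such that $G$ embeds as a virtual retract into the graph product $\Gamma\mathcal{G}$.
   Context: A connected simplicial graph $X$ is quasi-median if it contains neither $K_4^-$ (the complete graph on four vertices minus an edge) nor $K_{3,2}$ as an induced subgraph, and satisfies: (triangle condition) for all vertices $a,x,y$ with $x,y$ adjacent and $d(a,x)=d(a,y)$, there is a vertex $z$ adjacent to both $x,y$ with $d(a,z)=d(a,x)-1$; (quadrangle condition) for all vertices $a,x,y,z$ with $z$ adjacent to both $x$ and $y$ and $d(a,x)=d(a,y)=d(a,z)-1$, there is a vertex $w$ adjacent to both $x,y$ with $d(a,w)=d(a,z)-2$. A square is an induced 4-cycle; a clique is a maximal complete subgraph. A hyperplane is an equivalence class of edges for the transitive closure of the relation ''the two edges lie in a common triangle, or are opposite sides of a square''. The sectors of a hyperplane $J$ are the connected components of the graph obtained from $X$ by removing the interiors of all edges of $J$; $\mathscr{S}(J)$ denotes the set of sectors of $J$. The carrier $N(J)$ is the subgraph spanned by the edges of $J$. Two hyperplanes $J_1,J_2$ are transverse if there exist edges $e_1\in J_1$, $e_2 \in J_2$ which are two consecutive sides of a square; two distinct hyperplanes are tangent if they are not transverse and $N(J_1)\cap N(J_2)\neq\emptyset$. For a group $G$ acting by graph automorphisms on $X$ and a hyperplane $J$, $\mathfrak{S}(J)$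 denotes the image of $\mathrm{stab}_G(J)$ in the permutation group of $\mathscr{S}(J)$. The action is hyperplane-special if it is faithful and: (1) for every hyperplane $J$ and every $g\in G$ with $gJ\neq J$, $J$ and $gJ$ are neither transverse nor tangent; (2) for all transverse hyperplanes $J_1,J_2$ and every $g\in G$, $J_1$ and $gJ_2$ are not tangent. The action is special if it is hyperplane-special and, for every hyperplane $J$, the action $\mathfrak{S}(J)\curvearrowright\mathscr{S}(J)$ is free. Graph products: for a simplicial graph $\Gamma$ and a collection $\mathcal{G}=\{G_u\mid u\in V(\Gamma)\}$ of non-trivial groups, $\Gamma\mathcal{G}$ is the quotient of $\ast_u G_u$ by the relations $[g,h]=1$ for $g\in G_u$, $h\in G_v$, $\{u,v\}\in E(\Gamma)$. A subgroup $H\leq K$ is a virtual retract if there exist a finite-index subgroup $K'\leq K$ containing $H$ and a homomorphism $r:K'\to H$ with $r|_H=\mathrm{Id}_H$. *)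

(* Defs.v *)
From Stdlib Require Import List Relations Arith.
Import ListNotations.
Set Implicit Arguments.

Record Group := {
  gcar :> Type;
  gmul : gcar -> gcar -> gcar;
  gone : gcar;
  ginv : gcar -> gcar;
  gassoc : forall x y z, gmul x (gmul y z) = gmul (gmul x y) z;
  gone_l : forall x, gmul gone x = x;
  ginv_l : forall x, gmul (ginv x) x = gone }.

Arguments gmul {g} _ _.
Arguments gone {g}.
Arguments ginv {g} _.

Definition is_hom {A B : Group} (f : A -> B) : Prop :=
  forall x y, f (gmul x y) = gmul (f x) (f y).

Definition is_subgroup {A : Group} (H : A -> Prop) : Prop :=
  H gone /\ (forall x y, H x -> H y -> H (gmul x y)) /\ (forall x, H x -> H (ginv x)).

Definition finite_index {A : Group} (H : A -> Prop) : Prop :=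
  exists reps : list A, forall a : A, exists r, In r reps /\ H (gmul (ginv r) a).

Definition subgroups_isomorphic {A B : Group} (H : A -> Prop) (K : B -> Prop) : Prop :=
  exists f : A -> B,
    (forall h, H h -> K (f h)) /\
    (forall h1 h2, H h1 -> H h2 -> f h1 = f h2 -> h1 = h2) /\
    (forall k, K k -> exists h, H h /\ f h = k) /\
    (forall h1 h2, H h1 -> H h2 -> f (gmul h1 h2) = gmul (f h1) (f h2)).

Definition nontrivial_group (A : Group) : Prop := exists a : A, a <> gone.

Definition virtual_retract {K : Group} (H : K -> Prop) : Prop :=
  exists (K' : K -> Prop) (r : K -> K),
    is_subgroup K' /\ finite_index K' /\ (forall h, H h -> K' h) /\
    (forall x, K' x -> H (r x)) /\
    (forall x y, K' x -> K' y -> r (gmul x y) = gmul (r x) (r y)) /\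
    (forall h, H h -> r h = h).

(* ---------- Graph products (defined by their presentation, i.e. the
   universal property of the quotient of the free product) ---------- *)
Record SGraph := {
  vert :> Type;
  adj : vert -> vert -> Prop;
  adj_sym : forall x y, adj x y -> adj y x;
  adj_irrefl : forall x, ~ adj x x }.

Arguments adj {s} _ _.

Definition commuting_family {Gam : SGraph} (Gs : Gam -> Group) {Q : Group}
  (phi : forall u : Gam, Gs u -> Q) : Prop :=
  forall u v (a : Gs u) (b : Gs v), adj u v ->
    gmul (phi u a) (phi v b) = gmul (phi v b) (phi u a).

Definition is_graph_product {Gam : SGraph} (Gs : Gam -> Group) (P : Group)
  (iota : forall u : Gam, Gs u -> P) : Prop :=
  (forall u, is_hom (iota u)) /\ commuting_family Gs iota /\
  forall (Q : Group) (phi : forall u : Gam, Gs u -> Q),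
    (forall u, is_hom (phi u)) -> commuting_family Gs phi ->
    (exists f : P -> Q, is_hom f /\ forall u a, f (iota u a) = phi u a) /\
    (forall f1 f2 : P -> Q, is_hom f1 -> is_hom f2 ->
        (forall u a, f1 (iota u a) = phi u a) ->
        (forall u a, f2 (iota u a) = phi u a) -> forall x, f1 x = f2 x).

Inductive rwalk {V : Type} (R : V -> V -> Prop) : V -> V -> nat -> Prop :=
| rwalk0 : forall x, rwalk R x x 0
| rwalkS : forall x y z n, R x y -> rwalk R y z n -> rwalk R x z (S n).

Definition dist {X : SGraph} (x y : X) (n : nat) : Prop :=
  rwalk (@adj X) x y n /\ forall m, rwalk (@adj X) x y m -> n <= m.

Definition connected (X : SGraph) : Prop := forall x y : X, exists n, rwalk (@adj X) x y n.

Definition has_induced_K4minus (X : SGraph) : Prop :=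
  exists a b c d : X, c <> d /\
    adj a b /\ adj a c /\ adj a d /\ adj b c /\ adj b d /\ ~ adj c d.

Definition has_induced_K32 (X : SGraph) : Prop :=
  exists x1 x2 x3 y1 y2 : X,
    x1 <> x2 /\ x1 <> x3 /\ x2 <> x3 /\ y1 <> y2 /\
    adj x1 y1 /\ adj x2 y1 /\ adj x3 y1 /\ adj x1 y2 /\ adj x2 y2 /\ adj x3 y2 /\
    ~ adj x1 x2 /\ ~ adj x1 x3 /\ ~ adj x2 x3 /\ ~ adj y1 y2.

Definition triangle_condition (X : SGraph) : Prop :=
  forall (a x y : X) n, adj x y -> dist a x n -> dist a y n ->
    exists z, adj z x /\ adj z y /\ dist a z (n - 1).

Definition quadrangle_condition (X : SGraph) : Prop :=
  forall (a x y z : X) n, x <> y -> adj z x -> adj z y ->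
    dist a x n -> dist a y n -> dist a z (S n) ->
    exists w, adj w x /\ adj w y /\ dist a w (n - 1).

Definition quasi_median (X : SGraph) : Prop :=
  connected X /\ ~ has_induced_K4minus X /\ ~ has_induced_K32 X /\
  triangle_condition X /\ quadrangle_condition X.

Definition square {X : SGraph} (a b c d : X) : Prop :=
  a <> c /\ b <> d /\ adj a b /\ adj b c /\ adj c d /\ adj d a /\
  ~ adj a c /\ ~ adj b d.

Definition is_clique {X : SGraph} (C : X -> Prop) : Prop :=
  (exists x, C x) /\
  (forall x y, C x -> C y -> x <> y -> adj x y) /\
  (forall v, ~ C v -> exists c, C c /\ ~ adj v c).

(* Edges are represented by oriented pairs (u,v) with adj u v; the two
   orientations of an edge are identified by the relation below. *)
Definition oedge (X : SGraph) : Type := { p : X * X | adj (fst p) (snd p) }.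

Definition edge_elem {X : SGraph} (e f : oedge X) : Prop :=
  let (u, v) := proj1_sig e in let (u', v') := proj1_sig f in
  (u' = v /\ v' = u) \/
  (* the two edges lie in a common triangle *)
  (exists t : X, (t = u \/ t = v) /\ (t = u' \/ t = v') /\
      (forall p q : X, (p = u \/ p = v \/ p = u' \/ p = v') ->
                       (q = u \/ q = v \/ q = u' \/ q = v') -> p <> q -> adj p q)) \/
  square u v v' u' \/ square u v u' v'.

Definition hyp_equiv {X : SGraph} : oedge X -> oedge X -> Prop :=
  clos_refl_sym_trans (oedge X) (@edge_elem X).

(* A hyperplane, as the symmetric relation "u v span an edge of J" *)
Definition is_hyperplane {X : SGraph} (J : X -> X -> Prop) : Prop :=
  exists e0 : oedge X, forall u v : X,
    J u v <-> exists h : adj u v, hyp_equiv e0 (exist _ (u, v) h).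

Definition same_hyp {X : SGraph} (J1 J2 : X -> X -> Prop) : Prop :=
  forall u v, J1 u v <-> J2 u v.

Definition same_sector {X : SGraph} (J : X -> X -> Prop) (x y : X) : Prop :=
  exists n, rwalk (fun u v => adj u v /\ ~ J u v) x y n.

Definition transverse {X : SGraph} (J1 J2 : X -> X -> Prop) : Prop :=
  exists a b c d : X, square a b c d /\ J1 a b /\ J2 b c.

Definition carriers_meet {X : SGraph} (J1 J2 : X -> X -> Prop) : Prop :=
  exists v : X, (exists u, J1 v u) /\ (exists w, J2 v w).

Definition tangent {X : SGraph} (J1 J2 : X -> X -> Prop) : Prop :=
  ~ same_hyp J1 J2 /\ ~ transverse J1 J2 /\ carriers_meet J1 J2.

Definition is_action {G : Group} {X : SGraph} (act : G -> X -> X) : Prop :=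
  (forall x, act gone x = x) /\
  (forall g h x, act (gmul g h) x = act g (act h x)) /\
  (forall g x y, adj x y <-> adj (act g x) (act g y)).

Definition faithful_action {G : Group} {X : SGraph} (act : G -> X -> X) : Prop :=
  forall g, (forall x, act g x = x) -> g = gone.

Definition translate {G : Group} {X : SGraph} (act : G -> X -> X) (g : G)
  (J : X -> X -> Prop) : X -> X -> Prop :=
  fun u v => J (act (ginv g) u) (act (ginv g) v).

Definition hyperplane_special {G : Group} {X : SGraph} (act : G -> X -> X) : Prop :=
  faithful_action act /\
  (forall J g, is_hyperplane J -> ~ same_hyp (translate act g J) J ->
     ~ transverse J (translate act g J) /\ ~ tangent J (translate act g J)) /\
  (forall J1 J2 g, is_hyperplane J1 -> is_hyperplane J2 -> transverse J1 J2 ->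
     ~ tangent J1 (translate act g J2)).

Definition stab_hyp {G : Group} {X : SGraph} (act : G -> X -> X) (J : X -> X -> Prop) (g : G) : Prop :=
  same_hyp (translate act g J) J.

(* The image of stab_G(J) in the permutation group of the sectors of J acts
   freely: an element of stab_G(J) fixing one sector fixes every sector. *)
Definition sector_action_free {G : Group} {X : SGraph} (act : G -> X -> X)
  (J : X -> X -> Prop) : Prop :=
  forall g, stab_hyp act J g ->
    (exists x, same_sector J x (act g x)) -> forall y, same_sector J y (act g y).

Definition special_action {G : Group} {X : SGraph} (act : G -> X -> X) : Prop :=
  hyperplane_special act /\ forall J, is_hyperplane J -> sector_action_free act J.

Definition finitely_many_vertex_orbits {G : Group} {X : SGraph} (act : G -> X -> X) : Prop :=
  exists l : list X, forall v : X, exists w g, In w l /\ v = act g w.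

Definition stab_set {G : Group} {X : SGraph} (act : G -> X -> X) (C : X -> Prop) (g : G) : Prop :=
  forall v, C (act g v) <-> C v.

(* Main.v *)
Require Import Defs.
From Stdlib Require Import List Relations Arith Lia Classical ClassicalEpsilon.
From Stdlib Require Import FunctionalExtensionality PropExtensionality.

(** Let [Gam] have one vertex [u] for each [G]-orbit of hyperplanes, two orbits being
    adjacent when they have transverse representatives.  Fix a representative [J].  The
    image of stab(J) in the permutations of the sectors of [J] acts freely, with finitely
    many orbits, so its product [A u] with a finite cyclic group acts simply transitively
    on them; this labels the sectors of [J] by [A u].  Each sector of [J] meets a clique
    dual to [J] in exactly one vertex, so stab(C) acts on [C] like a finite-index
    subgroup of [A u] acts on the sectors.

    The labels make each [A u] act on the right on the vertices of [X]: an element moves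
    a vertex inside the clique through it dual to a hyperplane of the orbit [u], and fixes
    the vertex if there is none.  Specialness makes this clique unique, and makes [A u]
    and [A v] commute when [u] and [v] are adjacent, so the graph product [P] acts on the
    right, commuting with [G].  As [G] acts freely on vertices, the elements [p] such that
    [x0 p] lies in [G x0] form a finite-index subgroup with a homomorphism to [G],
    sending [p] to the [g] such that [x0 p = g x0].  A section [G -> P] sends [g] to the
    product of the labels along a path from [x0] to [g x0]; it does not depend on the path
    because the triangle and quadrangle conditions fill loops with triangles and
    squares. *)

(** * Distances *)

Lemma least_witness (P : nat -> Prop) :
  (exists n, P n) -> exists n, P n /\ forall m, P m -> n <= m.
Proof.
  intros [n Hn]. induction n as [n IH] using lt_wf_ind.
  destruct (classic (exists m, m < n /\ P m)) as [[m [Hm Pm]]|Hno].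
  - exact (IH m Hm Pm).
  - exists n. split; [assumption|]. intros m Pm.
    destruct (le_lt_dec n m); [assumption|]. exfalso. eauto.
Qed.

Section Walks.
Context {V : Type} {R : V -> V -> Prop}.

Lemma rwalk_app x y z n m : rwalk R x y n -> rwalk R y z m -> rwalk R x z (n + m).
Proof. induction 1; simpl; eauto using rwalk. Qed.

Lemma rwalk_rcons x y z n : rwalk R x y n -> R y z -> rwalk R x z (S n).
Proof.
  intros H1 H2. replace (S n) with (n + 1) by lia.
  eapply rwalk_app; eauto using rwalk.
Qed.

Lemma rwalk_rev x y n : (forall u v, R u v -> R v u) -> rwalk R x y n -> rwalk R y x n.
Proof. intros Hs. induction 1; eauto using rwalk, rwalk_rcons. Qed.

Lemma rwalk_last x z n : rwalk R x z (S n) -> exists y, rwalk R x y n /\ R y z.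
Proof.
  revert x. induction n as [|n IH]; intros x H; inversion H; subst.
  - match goal with H : rwalk R _ _ 0 |- _ => inversion H; subst end.
    eauto using rwalk.
  - match goal with H : rwalk R _ _ (S n) |- _ => apply IH in H as [w [? ?]] end.
    eauto using rwalk.
Qed.
End Walks.

(* Junk value when [x] and [y] lie in different components. *)
Definition gdist {X : SGraph} (x y : X) : nat := epsilon (inhabits 0) (dist x y).

Section Distance.
Context {X : SGraph} (Xconn : connected X).
Implicit Types a x y z : X.

Lemma gdistP x y : dist x y (gdist x y).
Proof.
  apply (epsilon_spec (inhabits 0) (dist x y)). destruct (least_witness _ (Xconn x y)) as [n [Hn Hle]].
  exists n. split; assumption.
Qed.

Lemma gdist_walk x y : rwalk (@adj X) x y (gdist x y).
Proof. apply gdistP. Qed.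

Lemma gdist_min x y n : rwalk (@adj X) x y n -> gdist x y <= n.
Proof. apply gdistP. Qed.

Lemma dist_gdist x y n : dist x y n -> n = gdist x y.
Proof.
  intros [H1 H2]. apply Nat.le_antisymm; [apply H2, gdist_walk | apply gdist_min, H1].
Qed.

Lemma gdist_refl x : gdist x x = 0.
Proof. assert (gdist x x <= 0) by (apply gdist_min; constructor). lia. Qed.

Lemma gdist_eq0 x y : gdist x y = 0 -> x = y.
Proof. intros H. pose proof (gdist_walk x y) as W. rewrite H in W. now inversion W. Qed.

Lemma gdist_sym x y : gdist x y = gdist y x.
Proof.
  apply Nat.le_antisymm; apply gdist_min, rwalk_rev, gdist_walk; apply adj_sym.
Qed.

Lemma gdist_adj x y : adj x y -> gdist x y = 1.
Proof.
  intros H. assert (gdist x y <= 1) by (apply gdist_min; eauto using rwalk).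
  destruct (gdist x y) eqn:E; [|lia].
  apply gdist_eq0 in E. subst. now apply adj_irrefl in H.
Qed.

Lemma gdist_eq1 x y : gdist x y = 1 -> adj x y.
Proof.
  intros H. pose proof (gdist_walk x y) as W. rewrite H in W. inversion W; subst.
  match goal with H : rwalk _ _ _ 0 |- _ => inversion H; subst end. assumption.
Qed.

Lemma gdist_adj_le a x y : adj x y -> gdist a y <= S (gdist a x).
Proof. intros H. apply gdist_min. eapply rwalk_rcons; eauto using gdist_walk. Qed.

Lemma gdist_adj_le_l a x y : adj x y -> gdist y a <= S (gdist x a).
Proof. rewrite (gdist_sym y), (gdist_sym x). apply gdist_adj_le. Qed.

Lemma gdist_pred a x n : gdist a x = S n -> exists y, adj y x /\ gdist a y = n.
Proof.
  intros H. pose proof (gdist_walk a x) as W. rewrite H in W.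
  apply rwalk_last in W as [y [W Hy]]. exists y. split; [assumption|].
  apply gdist_min in W. pose proof (gdist_adj_le a _ _ Hy). lia.
Qed.

Lemma gdist_eq2 x y z : adj x y -> adj x z -> y <> z -> ~ adj y z -> gdist y z = 2.
Proof.
  intros Hy Hz N1 N2. pose proof (gdist_adj_le y _ _ Hz) as L.
  rewrite (gdist_adj y x) in L by now apply adj_sym.
  destruct (gdist y z) as [|[|[|n]]] eqn:E; try lia.
  - now apply gdist_eq0 in E.
  - now apply gdist_eq1 in E.
Qed.
End Distance.

(** * Hyperplanes *)

Lemma square_flip {X : SGraph} (a b c d : X) : square a b c d -> square b a d c.
Proof.
  intros (?&?&?&?&?&?&?&?).
  repeat split; auto using adj_sym; intro; auto using adj_sym.
Qed.

Lemma square_transpose {X : SGraph} (a b c d : X) : square a b c d -> square a d c b.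
Proof.
  intros (?&?&?&?&?&?&?&?).
  repeat split; auto using adj_sym; intro; auto using adj_sym.
Qed.

Lemma square_opposite {X : SGraph} (a b c d : X) : square a b c d -> square d c b a.
Proof. intros H. apply square_transpose, square_flip, square_transpose, H. Qed.

Section Hyperplanes.
Context {X : SGraph}.
Implicit Types (J : X -> X -> Prop) (u v w x y : X).

Lemma hyp_adj J u v : is_hyperplane J -> J u v -> adj u v.
Proof. intros [e He] H. now apply He in H as [h _]. Qed.

Lemma hyp_step J u v u' v' (h : adj u v) (h' : adj u' v') :
  is_hyperplane J -> J u v -> edge_elem (exist _ (u, v) h) (exist _ (u', v') h') -> J u' v'.
Proof.
  intros [e He] H Hs. apply He in H as [h1 H]. apply He. exists h'.
  eapply rst_trans; [exact H|]. rewrite (proof_irrelevance _ h1 h). now apply rst_step.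
Qed.

Lemma hyp_sym J u v : is_hyperplane J -> J u v -> J v u.
Proof.
  intros HJ H. pose proof (hyp_adj _ _ _ HJ H) as h.
  apply (hyp_step J u v v u h (adj_sym _ _ _ h) HJ H). left. auto.
Qed.

Lemma hyp_triangle J u v w : is_hyperplane J -> J u v -> adj w u -> adj w v -> J u w.
Proof.
  intros HJ H Hu Hv. pose proof (hyp_adj _ _ _ HJ H) as h.
  apply (hyp_step J u v u w h (adj_sym _ _ _ Hu) HJ H). right. left.
  exists u. split; [auto|]. split; [auto|].
  intros p q [->|[->|[->| ->]]] [->|[->|[->| ->]]] N;
    try congruence; auto using adj_sym.
Qed.

Lemma hyp_square J u v u' v' : is_hyperplane J -> J u v -> square u v v' u' -> J u' v'.
Proof.
  intros HJ H S. pose proof (hyp_adj _ _ _ HJ H) as h.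
  assert (h' : adj u' v') by (apply adj_sym; apply S).
  apply (hyp_step J u v u' v' h h' HJ H). right. right. left. exact S.
Qed.

Lemma hyp_exists u v : adj u v -> exists J, is_hyperplane J /\ J u v.
Proof.
  intros h.
  exists (fun a b => exists h', hyp_equiv (exist _ (u, v) h) (exist _ (a, b) h')).
  split.
  - exists (exist _ (u, v) h). intros a b. reflexivity.
  - exists h. apply rst_refl.
Qed.

Lemma hyp_ext J J' : same_hyp J J' -> J = J'.
Proof.
  intros H. extensionality u. extensionality v. apply propositional_extensionality, H.
Qed.

Lemma hyp_equiv_unique J u v (h : adj u v) a b : is_hyperplane J -> J u v ->
  (J a b <-> exists h', hyp_equiv (exist _ (u, v) h) (exist _ (a, b) h')).
Proof.
  intros [e He] H. apply He in H as [h0 H]. rewrite (proof_irrelevance _ h0 h) in H.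
  rewrite (He a b). split; intros [h' H']; exists h'.
  - eapply rst_trans; [apply rst_sym, H | exact H'].
  - eapply rst_trans; [exact H | exact H'].
Qed.

Lemma hyp_unique J J' u v :
  is_hyperplane J -> is_hyperplane J' -> J u v -> J' u v -> J = J'.
Proof.
  intros HJ HJ' H H'. pose proof (hyp_adj _ _ _ HJ H) as h.
  apply hyp_ext. intros a b.
  rewrite (hyp_equiv_unique J u v h a b HJ H).
  rewrite (hyp_equiv_unique J' u v h a b HJ' H'). reflexivity.
Qed.

Lemma edge_elem_sym (e f : oedge X) : edge_elem e f -> edge_elem f e.
Proof.
  destruct e as [[u v] h], f as [[u' v'] h']. unfold edge_elem. simpl.
  intros [[-> ->]|[[t [A [B C]]]|[S|S]]].
  - auto.
  - right. left. exists t. split; [exact B|]. split; [exact A|].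
    intros p q Hp Hq. apply C; tauto.
  - right. right. left. exact (square_opposite _ _ _ _ S).
  - right. right. right. apply square_flip. exact (square_opposite _ _ _ _ S).
Qed.

(** Induction along a hyperplane, starting from one of its edges. Since [edge_elem] is symmetric,
    closure under the elementary moves makes [P] invariant in both directions, so the equivalence
    closure can be followed while staying in [J]. *)
Lemma hyp_ind J (P : X -> X -> Prop) a b : is_hyperplane J -> J a b -> P a b ->
  (forall u v, J u v -> P u v -> P v u) ->
  (forall u v w, J u v -> P u v -> adj w u -> adj w v -> P u w) ->
  (forall u v u' v', J u v -> P u v -> square u v v' u' -> P u' v') ->
  forall u v, J u v -> P u v.
Proof.
  intros HJ Hab Pab Psym Ptri Psq.
  assert (step : forall u v h u' v' h', J u v -> P u v ->
            edge_elem (exist _ (u, v) h) (exist _ (u', v') h') -> P u' v').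
  { intros u v h u' v' h' Huv Puv E. unfold edge_elem in E. simpl in *.
    destruct E as [[-> ->]|[[t [A [B C]]]|[S|S]]].
    - auto.
    (* [K] turns an edge about the shared endpoint [t]; it covers the degenerate case [v = v'],
       which [edge_elem] allows. *)
    - assert (K : forall t v v', J t v -> P t v -> adj t v' ->
                    (v <> v' -> adj v v') -> P t v').
      { intros t0 w w' J0 P0 H0 N0. destruct (classic (w = w')) as [<-|N]; [assumption|].
        apply (Ptri t0 w w' J0 P0); auto using adj_sym. }
      assert (C' : forall p q, (p = u \/ p = v) -> (q = u' \/ q = v') -> p <> q -> adj p q).
      { intros p q Hp Hq. apply C; tauto. }
      assert (Jvu : J v u) by now apply hyp_sym.
      assert (Pvu : P v u) by now apply Psym.
      assert (Ju'v' : J u' v').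
      { apply (hyp_step J u v u' v' h h' HJ Huv). right. left. exists t. auto. }
      destruct A as [-> | ->], B as [E1|E1].
      + subst u'. apply (K u v v'); auto.
      + subst v'. apply Psym; [now apply hyp_sym|].
        apply (K u v u'); auto using adj_sym.
      + subst u'. apply (K v u v'); auto.
      + subst v'. apply Psym; [now apply hyp_sym|].
        apply (K v u u'); auto using adj_sym.
    - eauto.
    - pose proof (hyp_square J u v v' u' HJ Huv S).
      apply Psym; eauto. }
  assert (main : forall e f : oedge X, hyp_equiv e f ->
    let '(u, v) := proj1_sig e in let '(u', v') := proj1_sig f in
    (J u v <-> J u' v') /\ (J u v -> (P u v <-> P u' v'))).
  { intros e f H. induction H as [e f H|e|e f H IH|e f g H1 IH1 H2 IH2].
    - pose proof (edge_elem_sym _ _ H) as H'.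
      destruct e as [[u v] h], f as [[u' v'] h']. simpl.
      assert (E : J u v <-> J u' v')
        by (split; intro K; eapply hyp_step; eauto).
      split; [exact E|]. intros Juv. split; intro K.
      + exact (step u v h u' v' h' Juv K H).
      + exact (step u' v' h' u v h (proj1 E Juv) K H').
    - destruct e as [[u v] h]. simpl. tauto.
    - destruct e as [[u v] h], f as [[u' v'] h']. simpl in *. tauto.
    - destruct e as [[u v] h], f as [[u' v'] h'], g as [[u'' v''] h'']. simpl in *. tauto. }
  intros u v Huv. pose proof (hyp_adj _ _ _ HJ Hab) as h.
  destruct (proj1 (hyp_equiv_unique J a b h u v HJ Hab) Huv) as [h' E].
  apply main in E. simpl in E. tauto.
Qed.
End Hyperplanes.

(** * Cliques and sectors in quasi-median graphs *)

(* When [a] and [b] are adjacent in a [K4^-]-free graph, this is the unique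
   clique containing both. *)
Definition clique_of {X : SGraph} (a b c : X) : Prop :=
  c = a \/ c = b \/ (adj c a /\ adj c b).

Definition nearest {X : SGraph} (a b x c : X) : Prop :=
  clique_of a b c /\
  forall c', clique_of a b c' -> c' <> c -> gdist x c' = S (gdist x c).

Definition same_projection {X : SGraph} (a b x y : X) : Prop :=
  exists c, nearest a b x c /\ nearest a b y c.

Section QuasiMedian.
Context {X : SGraph} (HX : quasi_median X).
Implicit Types (J : X -> X -> Prop) (a b c u v w x y z : X).

Lemma qm_connected : connected X.
Proof. apply HX. Qed.

Notation conn := qm_connected.

Lemma qm_K4minus a b c d :
  adj a b -> adj a c -> adj a d -> adj b c -> adj b d -> c <> d -> adj c d.
Proof.
  intros. apply NNPP. intro N. destruct HX as (_ & HK & _).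
  apply HK. exists a, b, c, d. repeat split; assumption.
Qed.

Lemma qm_triangle a x y : adj x y -> gdist a x = gdist a y ->
  exists z, adj z x /\ adj z y /\ S (gdist a z) = gdist a x.
Proof.
  intros H E. destruct HX as (_ & _ & _ & HT & _).
  destruct (HT a x y (gdist a x) H) as (z & Hzx & Hzy & Hz).
  - apply (gdistP conn).
  - rewrite E. apply (gdistP conn).
  - exists z. split; [assumption|]. split; [assumption|].
    (* The condition is stated with truncated [n - 1]; the value [n = 0] would give [x = a = y],
       against adjacency. *)
    apply (dist_gdist conn) in Hz.
    destruct (gdist a x) eqn:E0; [|lia].
    apply (gdist_eq0 conn) in E0. symmetry in E. apply (gdist_eq0 conn) in E.
    subst. now apply adj_irrefl in H.
Qed.

Lemma qm_quadrangle a x y z : x <> y -> adj z x -> adj z y ->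
  gdist a x = gdist a y -> gdist a z = S (gdist a x) ->
  exists w, adj w x /\ adj w y /\ S (gdist a w) = gdist a x.
Proof.
  intros N Hx Hy E Ez. destruct HX as (_ & _ & _ & _ & HQ).
  destruct (HQ a x y z (gdist a x) N Hx Hy) as (w & Hwx & Hwy & Hw).
  - apply (gdistP conn).
  - rewrite E. apply (gdistP conn).
  - rewrite <- Ez. apply (gdistP conn).
  - exists w. split; [assumption|]. split; [assumption|].
    apply (dist_gdist conn) in Hw.
    destruct (gdist a x) eqn:E0; [|lia].
    apply (gdist_eq0 conn) in E0. symmetry in E. apply (gdist_eq0 conn) in E.
    congruence.
Qed.

Lemma clique_of_adj a b c c' : adj a b ->
  clique_of a b c -> clique_of a b c' -> c <> c' -> adj c c'.
Proof.
  intros H [->|[->|[H1 H2]]] [->|[->|[H3 H4]]] N; auto using adj_sym; try congruence.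
  apply (qm_K4minus a b); auto using adj_sym.
Qed.

(** If [z] missed a vertex [e] of the clique, then [c], [c'], [z], [e] would induce a [K4^-] with
    missing edge [z e]. *)
Lemma clique_of_maximal a b c c' z : adj a b ->
  clique_of a b c -> clique_of a b c' -> c <> c' -> adj z c -> adj z c' ->
  clique_of a b z.
Proof.
  intros H Hc Hc' N Z Z'.
  assert (K : forall e, clique_of a b e -> z <> e -> adj z e).
  { intros e He Ne. destruct (classic (e = c)) as [->|N1]; [assumption|].
    destruct (classic (e = c')) as [->|N2]; [assumption|].
    apply (qm_K4minus c c'); auto using adj_sym.
    - now apply (clique_of_adj a b).
    - apply adj_sym, (clique_of_adj a b); auto.
    - apply adj_sym, (clique_of_adj a b); auto. }
  destruct (classic (z = a)); [left; assumption|].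
  destruct (classic (z = b)); [right; left; assumption|].
  right; right. split; apply K; auto; [left | right; left]; reflexivity.
Qed.

Lemma clique_of_eq a b c c' z : adj a b ->
  clique_of a b c -> clique_of a b c' -> c <> c' ->
  (clique_of c c' z <-> clique_of a b z).
Proof.
  intros H Hc Hc' N. split.
  - intros [->|[->|[Z Z']]]; auto. now apply (clique_of_maximal a b c c').
  - intros Hz. destruct (classic (z = c)); [left; assumption|].
    destruct (classic (z = c')); [right; left; assumption|].
    right; right. split; apply (clique_of_adj a b); auto.
Qed.

Lemma clique_of_is_clique a b : adj a b -> is_clique (clique_of a b).
Proof.
  intros H. split; [exists a; left; reflexivity|]. split.
  - intros x y. now apply clique_of_adj.
  - intros v Hv. apply NNPP. intro N. apply Hv. right; right.
    split; apply NNPP; intro M; apply N; [exists a | exists b];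
      (split; [|assumption]); [left | right; left]; reflexivity.
Qed.

(** If a second vertex of the clique attained the minimal distance, the triangle condition would
    give a strictly closer common neighbour, which lies in the clique by maximality. *)
Lemma nearest_exists a b x : adj a b -> exists c, nearest a b x c.
Proof.
  intros H.
  destruct (least_witness (fun n => exists c, clique_of a b c /\ gdist x c = n))
    as (n & (c & Hc & En) & Hmin).
  { exists (gdist x a), a. split; [left|]; reflexivity. }
  exists c. split; [assumption|]. intros c' Hc' N.
  assert (A : adj c' c) by now apply (clique_of_adj a b).
  pose proof (gdist_adj_le conn x _ _ (adj_sym _ _ _ A)) as L.
  assert (n <= gdist x c') as L' by (apply Hmin; eauto).
  assert (gdist x c' <> gdist x c); [|lia]. intro E.
  destruct (qm_triangle x c' c A E) as (z & Z1 & Z2 & Z3).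
  assert (clique_of a b z) by now apply (clique_of_maximal a b c' c).
  assert (n <= gdist x z) by (apply Hmin; eauto). lia.
Qed.

Lemma nearest_unique a b x c c' : nearest a b x c -> nearest a b x c' -> c = c'.
Proof.
  intros [H1 H2] [H1' H2']. apply NNPP. intro N.
  pose proof (H2 c' H1' (not_eq_sym N)). pose proof (H2' c H1 N). lia.
Qed.

Lemma nearest_self a b c : adj a b -> clique_of a b c -> nearest a b c c.
Proof.
  intros H Hc. split; [assumption|]. intros c' Hc' N.
  rewrite (gdist_refl conn). apply (gdist_adj conn), (clique_of_adj a b); auto.
Qed.

Lemma nearest_ext a b a' b' x c :
  (forall z, clique_of a b z <-> clique_of a' b' z) ->
  nearest a b x c -> nearest a' b' x c.
Proof. intros E [H1 H2]. split; [now apply E|]. intros c' Hc'. apply H2, E, Hc'. Qed.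

Lemma hyp_clique J a b c c' : is_hyperplane J -> J a b ->
  clique_of a b c -> clique_of a b c' -> c <> c' -> J c c'.
Proof.
  intros HJ H. pose proof (hyp_adj _ _ _ HJ H) as A.
  assert (K : forall c, clique_of a b c -> c <> a -> J a c).
  { intros c0 [->|[->|[H1 H2]]] N; [congruence|assumption|].
    now apply (hyp_triangle J a b). }
  intros Hc Hc' N.
  assert (Ha : clique_of a b a) by (left; reflexivity).
  destruct (classic (c = a)) as [->|N1]; [now apply K; auto|].
  destruct (classic (c' = a)) as [->|N2]; [apply hyp_sym; auto|].
  apply (hyp_triangle J c a c'); auto.
  - apply hyp_sym; auto.
  - apply (clique_of_adj a b); auto.
  - apply (clique_of_adj a b); auto.
Qed.

(* Only edges of the hyperplane of [ab] change the projection to the clique of [ab]: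
   push the edge one step closer to the clique with the quadrangle condition. *)
Lemma projection_edge J a b x y c c' : is_hyperplane J -> J a b -> adj x y ->
  nearest a b x c -> nearest a b y c' -> c <> c' -> J x y.
Proof.
  intros HJ H Axy [Hc Hx] [Hc' Hy] N.
  pose proof (hyp_adj _ _ _ HJ H) as A.
  assert (Acc : adj c c') by now apply (clique_of_adj a b).
  specialize (Hx c' Hc' (not_eq_sym N)). specialize (Hy c Hc N).
  rewrite !(gdist_sym conn x), !(gdist_sym conn y) in *.
  assert (Exy : gdist c' y = gdist c x).
  { pose proof (gdist_adj_le conn c _ _ Axy).
    pose proof (gdist_adj_le conn c' _ _ (adj_sym _ _ _ Axy)). lia. }
  assert (Jcc : J c c') by now apply (hyp_clique J a b).
  clear Hc Hc' H A.
  remember (gdist c x) as n eqn:En. symmetry in En.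
  revert x y Axy Hx Hy Exy En. induction n as [|n IH]; intros.
  - apply (gdist_eq0 conn) in En, Exy. congruence.
  - destruct (gdist_pred conn _ _ _ En) as (x' & Ax & Ex).
    assert (Ex' : gdist c' x' = S n).
    { pose proof (gdist_adj_le conn c' _ _ Ax).
      pose proof (gdist_adj_le_l conn x' _ _ Acc). lia. }
    destruct (qm_quadrangle c' y x' x) as (y' & Ay1 & Ay2 & Ey); auto using adj_sym; try lia.
    { intro E. subst x'. lia. }
    assert (Ey' : gdist c y' = S n).
    { pose proof (gdist_adj_le_l conn y' _ _ (adj_sym _ _ _ Acc)).
      pose proof (gdist_adj_le conn c _ _ Ay1). lia. }
    assert (J x' y') by (apply IH; auto using adj_sym; lia).
    apply (hyp_square J x' y'); auto.
    repeat split; auto using adj_sym.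
    + intro E. subst. lia.
    + intro E. subst. lia.
    + intro E. pose proof (gdist_adj_le conn c _ _ E). lia.
    + intro E. pose proof (gdist_adj_le conn c' _ _ E). lia.
Qed.

(** By [projection_edge], a path avoiding [J] never changes the projection to a clique dual to
    [J]. *)
Lemma sector_projection J a b x y : is_hyperplane J -> J a b ->
  same_sector J x y -> same_projection a b x y.
Proof.
  intros HJ H [n W]. pose proof (hyp_adj _ _ _ HJ H) as A.
  induction W as [x|x y z n [Axy Nxy] W (c & H1 & H2)].
  - destruct (nearest_exists a b x A) as [c Hc]. exists c. auto.
  - exists c. split; [|assumption].
    destruct (nearest_exists a b x A) as [c' Hc'].
    destruct (classic (c' = c)) as [->|N]; [assumption|].
    exfalso. apply Nxy. now apply (projection_edge J a b x y c' c).
Qed.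

Lemma not_same_projection a b c c' : adj a b ->
  clique_of a b c -> clique_of a b c' -> c <> c' -> ~ same_projection a b c c'.
Proof.
  intros A Hc Hc' N (e & H1 & H2). apply N.
  rewrite (nearest_unique a b c c e); auto using nearest_self.
  rewrite (nearest_unique a b c' c' e); auto using nearest_self.
Qed.

(** * Parallel cliques *)

Lemma square_edge {u v u' v'} : square u v v' u' -> adj u v /\ adj u' v'.
Proof. intros S. split; [|apply adj_sym]; apply S. Qed.

(** In the generic case the common vertex [z] is adjacent to [u], [v] and [u'], and the absence of
    [K4^-] forces the diagonal [v u'] of the square. *)
Lemma parallel_disjoint u v u' v' z : square u v v' u' ->
  clique_of u v z -> clique_of u' v' z -> False.
Proof.
  intros (N1 & N2 & A1 & A2 & A3 & A4 & M1 & M2).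
  intros [->|[->|[H1 H2]]] [->|[->|[H3 H4]]]; auto using adj_sym;
    try (now apply (adj_irrefl _ _ A2)); try (now apply (adj_irrefl _ _ A4)).
  apply M2. apply (qm_K4minus u z); auto using adj_sym.
Qed.

Lemma parallel_nonadj u v u' v' c c' e : square u v v' u' ->
  clique_of u v c -> clique_of u v e -> clique_of u' v' c' ->
  adj c c' -> c <> e -> ~ adj e c'.
Proof.
  intros S Hc He Hc' A N A'. apply (parallel_disjoint u v u' v' c' S); [|assumption].
  apply (clique_of_maximal u v c e); auto using adj_sym. apply S.
Qed.

Lemma square_parallel u v u' v' : square u v v' u' -> square u' v' v u.
Proof. apply square_opposite. Qed.

(** A third vertex [c] of the first clique is at distance 2 from both [u'] and [v'], so the triangle
    condition based at [c] yields its neighbour in the opposite clique. *)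
Lemma transport_exists u v u' v' c : square u v v' u' -> clique_of u v c ->
  exists c', clique_of u' v' c' /\ adj c c'.
Proof.
  intros S Hc. destruct (square_edge S) as [A A'].
  pose proof S as (N1 & N2 & A1 & A2 & A3 & A4 & M1 & M2).
  destruct Hc as [->|[->|[H1 H2]]].
  - exists u'. split; [left; reflexivity|auto using adj_sym].
  - exists v'. split; [right; left; reflexivity|assumption].
  - assert (Hc : clique_of u v c) by (right; right; auto).
    assert (Hu : clique_of u v u) by (left; reflexivity).
    assert (Hv : clique_of u v v) by (right; left; reflexivity).
    assert (Hu' : clique_of u' v' u') by (left; reflexivity).
    assert (Hv' : clique_of u' v' v') by (right; left; reflexivity).
    assert (c <> u) by (intro; subst; now apply (adj_irrefl _ _ H1)).
    assert (c <> v) by (intro; subst; now apply (adj_irrefl _ _ H2)).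
    assert (E1 : gdist c u' = 2).
    { apply (gdist_eq2 conn u); auto using adj_sym.
      - intro. subst. now apply (parallel_disjoint u v u' v' u').
      - apply (parallel_nonadj u v u' v' u); auto using adj_sym. }
    assert (E2 : gdist c v' = 2).
    { apply (gdist_eq2 conn v); auto using adj_sym.
      - intro. subst. now apply (parallel_disjoint u v u' v' v').
      - apply (parallel_nonadj u v u' v' v); auto using adj_sym. }
    destruct (qm_triangle c u' v' A') as (z & Z1 & Z2 & Z3); [lia|].
    exists z. split; [right; right; auto|]. apply (gdist_eq1 conn). lia.
Qed.

Lemma transport_square u v u' v' c : square u v v' u' -> clique_of u v c -> c <> u ->
  exists c', clique_of u' v' c' /\ square u c c' u'.
Proof.
  intros S Hc N. destruct (square_edge S) as [A A'].
  destruct (transport_exists u v u' v' c S Hc) as (c' & Hc' & Ac).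
  exists c'. split; [assumption|].
  assert (Hu : clique_of u v u) by (left; reflexivity).
  assert (Hu' : clique_of u' v' u') by (left; reflexivity).
  assert (Au : adj u u') by (apply adj_sym; apply S).
  assert (M1 : ~ adj u c') by (apply (parallel_nonadj u v u' v' c); auto).
  assert (M2 : ~ adj c u') by (apply (parallel_nonadj u v u' v' u); auto).
  repeat split; auto using adj_sym.
  - intros <-. now apply (parallel_disjoint u v u' v' u).
  - intros ->. now apply (parallel_disjoint u v u' v' u').
  - apply adj_sym, (clique_of_adj u v); auto.
  - apply (clique_of_adj u' v'); auto. intro E. subst. auto.
Qed.

(* If the projections to two parallel cliques did not correspond, the quadrangle
   condition would produce an induced [K_{3,2}]. *)
Lemma nearest_transport u v u' v' x c c' : square u v v' u' ->
  nearest u v x c -> clique_of u' v' c' -> adj c c' -> nearest u' v' x c'.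
Proof.
  intros S [Hc Hx] Hc' Acc. destruct (square_edge S) as [A A'].
  destruct (nearest_exists u' v' x A') as [e' [He' Hx']].
  destruct (classic (e' = c')) as [->|N]; [split; assumption|]. exfalso.
  pose proof (square_parallel _ _ _ _ S) as S'.
  destruct (transport_exists u' v' u v e' S' He') as (e & He & Ae).
  assert (Nce : c <> e).
  { intros <-. now apply (parallel_nonadj u' v' u v e' c c' S'); auto using adj_sym. }
  assert (M1 : ~ adj e c') by (apply (parallel_nonadj u v u' v' c); auto).
  assert (M2 : ~ adj c e') by (apply (parallel_nonadj u v u' v' e); auto using adj_sym).
  pose proof (Hx e He (not_eq_sym Nce)) as E1.
  pose proof (Hx' c' Hc' (not_eq_sym N)) as E2.
  pose proof (gdist_adj_le conn x _ _ Acc).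
  pose proof (gdist_adj_le conn x _ _ Ae).
  assert (Ece : adj c e) by now apply (clique_of_adj u v).
  assert (Ece' : adj c' e') by now apply (clique_of_adj u' v'); auto.
  (* Seen from [x], the vertices [c] and [e'] are at the same distance, [c'] and [e] one further and
     [w] one closer. Each of [c'], [e], [w] is adjacent to both [c] and [e']. *)
  destruct (qm_quadrangle x c e' c') as (w & W1 & W2 & W3); auto using adj_sym; try lia.
  { intros <-. apply (parallel_disjoint u v u' v' c); auto. }
  destruct HX as (_ & _ & H32 & _). apply H32.
  exists c', e, w, c, e'.
  repeat split; auto using adj_sym; try (intro E; subst; lia).
  - intros <-. now apply (parallel_disjoint u v u' v' c').
  - intros <-. now apply (parallel_disjoint u v u' v' c).
  - intro E. pose proof (gdist_adj_le conn x _ _ (adj_sym _ _ _ E)). lia.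
  - intro E. pose proof (gdist_adj_le conn x _ _ (adj_sym _ _ _ E)). lia.
Qed.

(** Projections to parallel cliques match by [nearest_transport], so [hyp_ind] carries the relation
    from one clique dual to [J] to all the others. *)
Lemma same_projection_hyp J a b u v x y : is_hyperplane J -> J a b -> J u v ->
  same_projection a b x y -> same_projection u v x y.
Proof.
  intros HJ Hab Huv Hxy.
  revert u v Huv. apply (hyp_ind J (fun u v => same_projection u v x y) a b HJ Hab Hxy).
  - intros u v _ (c & H1 & H2). exists c.
    split; (eapply nearest_ext; [|eassumption]); unfold clique_of; tauto.
  - intros u v w Huv (c & H1 & H2) Wu Wv. exists c.
    assert (E : forall z, clique_of u v z <-> clique_of u w z).
    { intros z. symmetry. pose proof (hyp_adj _ _ _ HJ Huv).
      apply clique_of_eq; auto; [left|right; right|]; auto.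
      intros ->. now apply adj_irrefl in Wu. }
    split; (eapply nearest_ext; [apply E|assumption]).
  - intros u v u' v' Huv (c & H1 & H2) S.
    destruct (transport_exists u v u' v' c S (proj1 H1)) as (c' & Hc' & Ac).
    exists c'. split; eapply nearest_transport; eauto.
Qed.

(** * Sectors and transverse hyperplanes *)

Lemma same_sector_trans J x y z :
  same_sector J x y -> same_sector J y z -> same_sector J x z.
Proof. intros [n H] [m H']. exists (n + m). eapply rwalk_app; eauto. Qed.

Lemma same_sector_sym J x y : is_hyperplane J -> same_sector J x y -> same_sector J y x.
Proof.
  intros HJ [n H]. exists n. apply rwalk_rev; [|assumption].
  intros u v [A N]. split; [now apply adj_sym|]. intro. now apply N, hyp_sym.
Qed.

Lemma same_sector_refl J x : same_sector J x x.
Proof. exists 0. constructor. Qed.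

Lemma same_sector_edge J x y : adj x y -> ~ J x y -> same_sector J x y.
Proof. intros A N. exists 1. eauto using rwalk. Qed.

(** Each endpoint is its own projection to the clique of [u v], whereas a sector has a single
    projection. *)
Lemma hyp_separates J u v : is_hyperplane J -> J u v -> ~ same_sector J u v.
Proof.
  intros HJ H K. apply (sector_projection J u v u v HJ H) in K.
  pose proof (hyp_adj _ _ _ HJ H) as A. revert K.
  apply not_same_projection; auto; [left|right; left|]; auto.
  intros ->. now apply adj_irrefl in A.
Qed.

(** If [y] and [z] were not adjacent, [z] would be at distance 2 from every vertex other than [x] of
    the clique of [x y], so [x] and [z] would both project to [x]. Carried along [J], this would
    give them the same projection to the clique of [x z], which contains both. *)
Lemma hyp_fan J x y z : is_hyperplane J -> J x y -> J x z -> y <> z -> adj y z.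
Proof.
  intros HJ Hy Hz N.
  pose proof (hyp_adj _ _ _ HJ Hy) as Ay. pose proof (hyp_adj _ _ _ HJ Hz) as Az.
  apply NNPP. intro M.
  assert (K : same_projection x y x z).
  { exists x. split; [apply nearest_self; auto; left; reflexivity|].
    split; [left; reflexivity|]. intros c Hc Nc.
    rewrite (gdist_sym conn z x), (gdist_adj conn x z Az).
    assert (Acx : adj c x).
    { apply (clique_of_adj x y); auto. left; reflexivity. }
    apply (gdist_eq2 conn x); auto using adj_sym.
    - intros ->. destruct Hc as [->|[->|[H1 H2]]]; auto using adj_sym.
    - intro Azc. destruct Hc as [->|[->|[H1 H2]]]; auto using adj_sym.
      apply M. apply adj_sym, (qm_K4minus x c); auto using adj_sym. }
  apply (same_projection_hyp J x y x z _ _ HJ Hy Hz) in K. revert K.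
  apply not_same_projection; auto; [left|right; left|]; auto.
  intros ->. now apply adj_irrefl in Az.
Qed.

Lemma square_sides J u v u' v' :
  is_hyperplane J -> J u v -> square u v v' u' -> ~ J u u'.
Proof.
  intros HJ H S H'. apply S. apply (hyp_fan J u); auto. apply S.
Qed.

(** A vertex of the sector is passed from one dual clique to a parallel one along the matching edge.
    That edge is not in [J]: otherwise [hyp_fan] would make the new vertex adjacent to a second
    vertex of the old clique. *)
Lemma sector_meets_clique J x y a b : is_hyperplane J -> J x y -> J a b ->
  exists c, clique_of a b c /\ same_sector J x c.
Proof.
  intros HJ Hxy. revert a b.
  apply (hyp_ind J (fun a b => exists c, clique_of a b c /\ same_sector J x c) x y);
    auto.
  - exists x. split; [left; reflexivity|apply same_sector_refl].
  - intros u v _ (c & H1 & H2). exists c. split; [|assumption].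
    unfold clique_of in *. tauto.
  - intros u v w Huv (c & H1 & H2) Wu Wv. exists c. split; [|assumption].
    pose proof (hyp_adj _ _ _ HJ Huv).
    apply clique_of_eq with (a := u) (b := v); auto; [left|right; right|]; auto.
    intros ->. now apply adj_irrefl in Wu.
  - intros u v u' v' Huv (c & H1 & H2) S.
    destruct (transport_exists u v u' v' c S H1) as (c' & Hc' & Ac).
    exists c'. split; [assumption|].
    eapply same_sector_trans; [eassumption|]. apply same_sector_edge; [assumption|].
    intro Jc. pose proof (hyp_adj _ _ _ HJ Huv) as A.
    assert (Ne : exists e, clique_of u v e /\ c <> e).
    { destruct (classic (c = u)) as [->|N].
      - exists v. split; [right; left; reflexivity|]. intros ->. now apply adj_irrefl in A.
      - exists u. split; [left; reflexivity|assumption]. }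
    destruct Ne as (e & He & N).
    apply (parallel_nonadj u v u' v' c c' e S); auto.
    apply (hyp_fan J c); auto.
    + now apply (hyp_clique J u v).
    + intros <-. now apply (parallel_disjoint u v u' v' e).
Qed.

(** A walk from [x] to [a] stays in the sector of [x] until it first crosses [J], where
    [sector_meets_clique] applies, or until it reaches [a]. *)
Lemma every_sector_meets_clique J x a b : is_hyperplane J -> J a b ->
  exists c, clique_of a b c /\ same_sector J x c.
Proof.
  intros HJ Hab. destruct (conn x a) as [n W].
  assert (Ha : clique_of a b a) by (left; reflexivity).
  remember a as t eqn:Et in W.
  induction W as [x|x y z n Axy W IH]; subst.
  - exists a. split; [assumption|apply same_sector_refl].
  - destruct (classic (J x y)) as [H|H].
    + now apply (sector_meets_clique J x y).
    + destruct (IH eq_refl) as (c & H1 & H2). exists c. split; [assumption|].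
      eapply same_sector_trans; [|eassumption]. now apply same_sector_edge.
Qed.

Lemma sector_toward J x y p : is_hyperplane J -> J x y -> same_sector J y p ->
  gdist p x = S (gdist p y).
Proof.
  intros HJ H Hp. pose proof (hyp_adj _ _ _ HJ H) as A.
  apply (sector_projection J x y _ _ HJ H) in Hp as (c & H1 & H2).
  assert (Hy : clique_of x y y) by (right; left; reflexivity).
  rewrite <- (nearest_unique x y y y c) in H2; auto using nearest_self.
  apply H2; [left; reflexivity|]. intros ->. now apply adj_irrefl in A.
Qed.

(** The cliques dual to [J1] and [J2] through the vertex [b] of a square span a product. The two
    sectors select [y1] and [z1] in these cliques, and the fourth corner of the square on [y1], [b],
    [z1] lies in both sectors; the cases [y1 = b] and [z1 = b] are degenerate. *)
Lemma transverse_corner J1 J2 y z : is_hyperplane J1 -> is_hyperplane J2 ->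
  transverse J1 J2 -> J1 <> J2 ->
  exists p, same_sector J1 y p /\ same_sector J2 z p.
Proof.
  intros HJ1 HJ2 (a & b & c & e & S & H1 & H2) N.
  destruct (every_sector_meets_clique J1 y a b HJ1 H1) as (y1 & Hy1 & Sy).
  destruct (every_sector_meets_clique J2 z b c HJ2 H2) as (z1 & Hz1 & Sz).
  assert (D1 : forall u v, J1 u v -> ~ J2 u v) by (intros u v Q R; eauto using hyp_unique).
  assert (Hb : clique_of a b b) by (right; left; reflexivity).
  assert (Hb' : clique_of b c b) by (left; reflexivity).
  destruct (classic (y1 = b)) as [->|Ny].
  - exists z1. split; [|assumption].
    destruct (classic (z1 = b)) as [->|Nz]; [assumption|].
    assert (K : J2 b z1) by (apply (hyp_clique J2 b c); auto).
    eapply same_sector_trans; [eassumption|]. apply same_sector_edge.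
    + now apply (hyp_adj J2).
    + intro. now apply (D1 b z1).
  - assert (Ky : J1 b y1) by (apply (hyp_clique J1 a b); auto).
    destruct (classic (z1 = b)) as [->|Nz].
    + exists y1. split; [assumption|]. eapply same_sector_trans; [eassumption|].
      apply same_sector_edge; [now apply (hyp_adj J1)|now apply D1].
    + assert (S1 : square b a e c) by now apply square_flip.
      destruct (transport_square b a c e y1 S1) as (y2 & Hy2 & S2); auto.
      { unfold clique_of in *. tauto. }
      apply square_transpose in S2.
      destruct (transport_square b c y1 y2 z1 S2) as (p & Hp & S3); auto.
      assert (K2 : J2 y1 p).
      { apply (hyp_square J2 b z1); auto. apply (hyp_clique J2 b c); auto. }
      assert (K1 : J1 z1 p).
      { apply (hyp_square J1 b y1); auto. now apply square_transpose. }
      exists p. split; eapply same_sector_trans; try eassumption; apply same_sector_edge.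
      * now apply (hyp_adj J2).
      * intro. now apply (D1 y1 p).
      * now apply (hyp_adj J1).
      * now apply D1.
Qed.

Lemma transverse_neq J1 J2 : is_hyperplane J1 -> transverse J1 J2 -> J1 <> J2.
Proof.
  intros HJ (a & b & c & e & S & H1 & H2) <-.
  apply (square_sides J1 b a c e); auto; [now apply hyp_sym|now apply square_flip].
Qed.

(** Seen from a vertex [p] in both the [J1]-sector of [y] and the [J2]-sector of [z], both [y] and
    [z] are one step closer than [x]; the quadrangle condition then closes the square. *)
Lemma transverse_square J1 J2 x y z : is_hyperplane J1 -> is_hyperplane J2 ->
  transverse J1 J2 -> J1 x y -> J2 x z -> exists w, square x y w z.
Proof.
  intros HJ1 HJ2 T Hy Hz. pose proof (transverse_neq _ _ HJ1 T) as N.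
  assert (Nyz : y <> z) by (intros ->; eauto using hyp_unique).
  destruct (transverse_corner J1 J2 y z HJ1 HJ2 T N) as (p & P1 & P2).
  pose proof (sector_toward J1 x y p HJ1 Hy P1) as E1.
  pose proof (sector_toward J2 x z p HJ2 Hz P2) as E2.
  pose proof (hyp_adj _ _ _ HJ1 Hy) as Ay. pose proof (hyp_adj _ _ _ HJ2 Hz) as Az.
  destruct (qm_quadrangle p y z x) as (w & W1 & W2 & W3); auto; [lia|].
  exists w. repeat split; auto using adj_sym.
  - intros ->. lia.
  - intro A. pose proof (gdist_adj_le conn p _ _ (adj_sym _ _ _ A)). lia.
  - intro A. apply N. apply (hyp_unique J1 J2 x z); auto.
    apply (hyp_triangle J1 x y); auto using adj_sym.
Qed.
End QuasiMedian.

(** * Groups *)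

Section Groups.
Context {A : Group}.
Implicit Types x y z : A.

Lemma gcancel_l x y z : gmul x y = gmul x z -> y = z.
Proof.
  intros E. rewrite <- (gone_l _ y), <- (gone_l _ z), <- (ginv_l _ x), <- !gassoc.
  now rewrite E.
Qed.

Lemma ginv_r x : gmul x (ginv x) = gone.
Proof.
  apply (gcancel_l (ginv x)). rewrite gassoc, ginv_l, gone_l.
  apply (gcancel_l (ginv (ginv x))). now rewrite gassoc, !ginv_l, gone_l.
Qed.

Lemma gone_r x : gmul x gone = x.
Proof. now rewrite <- (ginv_l _ x), gassoc, ginv_r, gone_l. Qed.

Lemma ginv_unique x y : gmul x y = gone -> y = ginv x.
Proof. intros E. apply (gcancel_l x). now rewrite E, ginv_r. Qed.

Lemma ginv_ginv x : ginv (ginv x) = x.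
Proof. symmetry. apply ginv_unique, ginv_l. Qed.

Lemma gmul_idem x : gmul x x = x -> x = gone.
Proof. intros E. apply (gcancel_l x). now rewrite E, gone_r. Qed.

Lemma gcancel_r x y z : gmul y x = gmul z x -> y = z.
Proof.
  intros E. rewrite <- (gone_r y), <- (gone_r z), <- (ginv_r x), !gassoc. now rewrite E.
Qed.
End Groups.

Lemma hom_one {A B : Group} (f : A -> B) : is_hom f -> f gone = gone.
Proof. intros H. apply gmul_idem. now rewrite <- H, gone_l. Qed.

Lemma hom_inv {A B : Group} (f : A -> B) x : is_hom f -> f (ginv x) = ginv (f x).
Proof.
  intros H. apply ginv_unique. now rewrite <- H, ginv_r, hom_one.
Qed.

(** * Choice, quotients and constructions of groups *)

Lemma dependent_choice {T : Type} {B : T -> Type} (R : forall x, B x -> Prop) :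
  (forall x, exists y, R x y) -> exists f : forall x, B x, forall x, R x (f x).
Proof.
  intros H. exists (fun x => proj1_sig (constructive_indefinite_description _ (H x))).
  intros x. apply proj2_sig.
Qed.

(** For related [x] and [y] the predicates [R x] and [R y] are equal by extensionality, so [epsilon]
    selects the same representative. The quotient consists of the fixed points of [canon]. *)
Lemma quotient_exists {T : Type} (R : T -> T -> Prop) : equivalence T R ->
  exists (Q : Type) (cl : T -> Q),
    (forall q, exists x, cl x = q) /\ (forall x y, cl x = cl y <-> R x y).
Proof.
  intros [Rr Rt Rs].
  set (canon x := epsilon (inhabits x) (R x)).
  assert (C1 : forall x, R x (canon x)) by (intros x; apply epsilon_spec; exists x; apply Rr).
  assert (C2 : forall x y, R x y -> canon x = canon y).
  { intros x y H. unfold canon.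
    assert (R x = R y) as ->.
    { extensionality z. apply propositional_extensionality. split; intro; eauto. }
    now rewrite (proof_irrelevance _ (inhabits x) (inhabits y)). }
  assert (C3 : forall x, canon (canon x) = canon x) by (intros; symmetry; auto).
  exists {x | canon x = x}, (fun x => exist (fun x => canon x = x) (canon x) (C3 x)). split.
  - intros [x Hx]. exists x. apply eq_sig_hprop; [intros; apply proof_irrelevance|exact Hx].
  - intros x y. split.
    + intros E. apply (f_equal (@proj1_sig _ _)) in E. simpl in E.
      apply Rt with (canon x); [apply C1|]. rewrite E. apply Rs, C1.
    + intros H. apply eq_sig_hprop; [intros; apply proof_irrelevance|simpl; auto].
Qed.

Lemma quotient_group_exists {T : Type} (R : T -> T -> Prop)
  (mul : T -> T -> T) (one : T) (inv : T -> T) : equivalence T R ->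
  (forall x x' y y', R x x' -> R y y' -> R (mul x y) (mul x' y')) ->
  (forall x y z, R (mul x (mul y z)) (mul (mul x y) z)) ->
  (forall x, R (mul one x) x) -> (forall x, R (mul (inv x) x) one) ->
  exists (A : Group) (cl : T -> A),
    (forall q, exists x, cl x = q) /\ (forall x y, cl x = cl y <-> R x y) /\
    (forall x y, cl (mul x y) = gmul (cl x) (cl y)).
Proof.
  intros Re Rm Ra R1 Ri.
  destruct (quotient_exists R Re) as (Q & cl & Hsurj & Hcl).
  destruct (dependent_choice (fun q x => cl x = q) Hsurj) as [rep Hrep].
  assert (Rrep : forall x, R (rep (cl x)) x) by (intros; apply Hcl, Hrep).
  assert (Rr : forall x, R x x) by apply Re.
  assert (Hm : forall x y, cl (mul (rep (cl x)) (rep (cl y))) = cl (mul x y))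
    by (intros; apply Hcl; auto).
  unshelve eexists (@Build_Group Q
    (fun p q => cl (mul (rep p) (rep q))) (cl one)
    (fun p => cl (inv (rep p))) _ _ _).
  - intros p q r. destruct (Hsurj p) as [x <-], (Hsurj q) as [y <-], (Hsurj r) as [z <-].
    rewrite (Hm y z), (Hm x y), !Hm. apply Hcl, Ra.
  - intros p. destruct (Hsurj p) as [x <-]. rewrite Hm. apply Hcl, R1.
  - intros p. destruct (Hsurj p) as [x <-].
    rewrite <- (Hrep (cl x)) at 2. rewrite Hm. apply Hcl, Ri.
  - exists cl. split; [exact Hsurj|]. split; [exact Hcl|].
    intros x y. simpl. symmetry. apply Hm.
Qed.

(* Two words are identified when every commuting family of homomorphisms gives
   them the same value; this avoids any normal form. *)
Lemma graph_product_exists (Gam : SGraph) (Gs : Gam -> Group) :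
  exists (P : Group) (iota : forall u : Gam, Gs u -> P), is_graph_product Gs P iota.
Proof.
  set (ev (Q : Group) (phi : forall u : Gam, Gs u -> Q) :=
    fix ev (w : list {u : Gam & Gs u}) : Q :=
      match w with
      | nil => gone
      | (existT _ u a :: w)%list => gmul (phi u a) (ev w)
      end).
  set (R w w' := forall (Q : Group) (phi : forall u : Gam, Gs u -> Q),
    (forall u, is_hom (phi u)) -> commuting_family Gs phi -> ev Q phi w = ev Q phi w').
  assert (ev_app : forall Q phi w w',
    ev Q phi (w ++ w')%list = gmul (ev Q phi w) (ev Q phi w')).
  { intros Q phi w w'. induction w as [|[u a] w IH]; simpl.
    - now rewrite gone_l.
    - now rewrite IH, gassoc. }
  set (inv := fix inv (w : list {u : Gam & Gs u}) :=
    match w with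
    | nil => nil
    | (existT _ u a :: w)%list => (inv w ++ (existT _ u (ginv a)) :: nil)%list
    end).
  destruct (quotient_group_exists R (@app _) nil inv) as (P & cl & Hs & Hcl & Hm).
  - split.
    + intros w Q phi H1 H2. reflexivity.
    + intros w1 w2 w3 H H' Q phi H1 H2. now rewrite H, H'.
    + intros w1 w2 H Q phi H1 H2. now rewrite H.
  - intros w1 w1' w2 w2' H H' Q phi H1 H2. now rewrite !ev_app, (H Q phi), (H' Q phi).
  - intros w1 w2 w3 Q phi H1 H2. now rewrite !ev_app, gassoc.
  - intros w Q phi H1 H2. reflexivity.
  - intros w Q phi H1 H2. rewrite ev_app.
    induction w as [|[u a] w IH]; simpl in *.
    + apply gone_l.
    + rewrite ev_app. simpl. rewrite (hom_inv _ a (H1 u)), gone_r.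
      rewrite <- gassoc, (gassoc _ (ginv _)), ginv_l, gone_l. exact IH.
  - assert (Hone : cl nil = gone).
    { apply gmul_idem. now rewrite <- Hm. }
    set (iota u (a : Gs u) := cl (existT _ u a :: nil)%list).
    assert (Hcons : forall u a w, cl (existT _ u a :: w)%list = gmul (iota u a) (cl w)).
    { intros u a w. unfold iota. now rewrite <- Hm. }
    exists P, iota. split; [|split].
    + intros u a b. unfold iota. rewrite <- Hm. apply Hcl. intros Q phi H1 H2.
      simpl. now rewrite H1, !gone_r.
    + intros u v a b Huv. unfold iota. rewrite <- !Hm. apply Hcl. intros Q phi H1 H2.
      simpl. rewrite !gone_r. now apply H2.
    + intros Q phi H1 H2. split.
      * destruct (dependent_choice (fun p w => cl w = p) Hs) as [rep Hrep].
        assert (Hev : forall w, ev Q phi (rep (cl w)) = ev Q phi w).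
        { intros w. apply (proj1 (Hcl _ _) (Hrep (cl w)) Q phi); assumption. }
        exists (fun p => ev Q phi (rep p)). split.
        -- intros p q. destruct (Hs p) as [w <-], (Hs q) as [w' <-].
           rewrite <- Hm, !Hev. apply ev_app.
        -- intros u a. unfold iota. rewrite Hev. simpl. apply gone_r.
      * intros f1 f2 F1 F2 E1 E2 p. destruct (Hs p) as [w <-].
        induction w as [|[u a] w IH].
        -- now rewrite Hone, (hom_one f1), (hom_one f2).
        -- now rewrite Hcons, F1, F2, E1, E2, IH.
Qed.

(** The target to which the universal property of the graph product is applied. Products compose
    from left to right, so that the group acts on the right. An element is a pair of mutually
    inverse maps, taken up to equality of the forward maps. *)
Lemma equivariant_permutations_exist {G : Group} {T : Type} (act : G -> T -> T) :
  exists (Q : Group) (ev : T -> Q -> T),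
    (forall x p q, ev x (gmul p q) = ev (ev x p) q) /\
    (forall p q, (forall x, ev x p = ev x q) -> p = q) /\
    (forall g x p, act g (ev x p) = ev (act g x) p) /\
    (forall f f' : T -> T, (forall x, f (f' x) = x) -> (forall x, f' (f x) = x) ->
       (forall g x, act g (f x) = f (act g x)) -> exists p, forall x, ev x p = f x).
Proof.
  set (D := {f : (T -> T) * (T -> T) |
    (forall x, fst f (snd f x) = x) /\ (forall x, snd f (fst f x) = x) /\
    (forall g x, act g (fst f x) = fst f (act g x))}).
  set (R (p q : D) := forall x, fst (proj1_sig p) x = fst (proj1_sig q) x).
  assert (mulP : forall p q : D, exists r : D,
    forall x, fst (proj1_sig r) x = fst (proj1_sig q) (fst (proj1_sig p) x)).
  { intros [[f f'] [F1 [F2 F3]]] [[h h'] [H1 [H2 H3]]]. simpl in *.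
    unshelve eexists.
    - exists (fun x => h (f x), fun x => f' (h' x)). simpl.
      repeat split; intros; rewrite ?F1, ?F2, ?H1, ?H2, ?H3, ?F3; auto.
    - reflexivity. }
  assert (invP : forall p : D, exists r : D,
    forall x, fst (proj1_sig p) (fst (proj1_sig r) x) = x).
  { intros [[f f'] [F1 [F2 F3]]]. simpl in *.
    unshelve eexists.
    - exists (f', f). simpl. repeat split; auto.
      intros g x. rewrite <- (F1 x) at 2. now rewrite F3, F2.
    - exact F1. }
  assert (one : D) by (exists (fun x => x, fun x => x); auto).
  destruct (dependent_choice _ (fun p => dependent_choice _ (mulP p))) as [mul Hmul].
  apply dependent_choice in invP as [inv Hinv].
  (* The content of [one] is hidden by [assert]; [mul (inv one) one] is the identity by [Hmul] and
     [Hinv] alone. *)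
  set (one' := mul (inv one) one).
  destruct (quotient_group_exists R mul one' inv)
    as (Q & cl & Hs & Hcl & Hm).
  - split.
    + intros p x. reflexivity.
    + intros p q r H H' x. now rewrite H, H'.
    + intros p q H x. now rewrite H.
  - intros p p' q q' H H' x. rewrite !Hmul. simpl. now rewrite H, H'.
  - intros p q r x. now rewrite !Hmul.
  - intros p x. rewrite Hmul. simpl. f_equal. unfold one'. rewrite Hmul. simpl. apply Hinv.
  - intros p x. unfold one'. rewrite !Hmul. simpl. now rewrite !Hinv.
  - apply dependent_choice in Hs as [rep Hrep].
    assert (Erep : forall p x, fst (proj1_sig (rep (cl p))) x = fst (proj1_sig p) x)
      by (intros p; apply (proj1 (Hcl _ _) (Hrep (cl p)))).
    exists Q, (fun x q => fst (proj1_sig (rep q)) x). repeat split.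
    + intros x p q. rewrite <- (Hrep p), <- (Hrep q), <- Hm, !Erep. apply Hmul.
    + intros p q H. rewrite <- (Hrep p), <- (Hrep q). apply Hcl. exact H.
    + intros g x p. apply (proj2_sig (rep p)).
    + intros f f' F1 F2 F3. unshelve eexists.
      * apply cl. exists (f, f'). auto.
      * intros x. apply Erep.
Qed.

Lemma list_transversal {T : Type} (R : T -> T -> Prop) (d : T) (l : list T) :
  equivalence T R -> exists l', incl l' l /\
    (forall x, In x l -> exists t, In t l' /\ R t x) /\
    (forall i j, i < length l' -> j < length l' -> R (nth i l' d) (nth j l' d) -> i = j).
Proof.
  intros [Rr Rt Rs]. induction l as [|x l (l' & I1 & I2 & I3)].
  - exists nil. repeat split; simpl; [intros ? []|intros ? []|lia].
  - destruct (classic (exists t, In t l' /\ R t x)) as [(t & Ht & Htx)|N].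
    + exists l'. repeat split; auto using incl_tl.
      intros y [<-|Hy]; eauto.
    + exists (x :: l')%list. repeat split.
      * apply incl_cons; [left; reflexivity|now apply incl_tl].
      * intros y [<-|Hy]; [exists x; split; [left; reflexivity|apply Rr]|].
        destruct (I2 y Hy) as (t & Ht & Hty). exists t. split; [right|]; assumption.
      * intros [|i] [|j] Hi Hj H; simpl in *; auto.
        -- exfalso. apply N. exists (nth j l' d). split; [apply nth_In; lia|auto].
        -- exfalso. apply N. exists (nth i l' d). split; [apply nth_In; lia|auto].
        -- f_equal. apply I3; auto; lia.
Qed.

(* A group acting freely with finitely many orbits on the classes of [E] extends to a
   group acting simply transitively on them: its product with a finite cyclic group
   whose order is the number of orbits. *)
Lemma simply_transitive_extension {G : Group} {T : Type} (act : G -> T -> T)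
  (S : G -> Prop) (E : T -> T -> Prop) (x0 : T) (l : list T) :
  (forall x, act gone x = x) -> (forall g h x, act (gmul g h) x = act g (act h x)) ->
  is_subgroup S -> equivalence T E ->
  (forall g x y, S g -> E x y -> E (act g x) (act g y)) ->
  (forall g x y, S g -> E x (act g x) -> E y (act g y)) ->
  (forall x, exists t g, In t l /\ S g /\ E (act g t) x) ->
  exists (A : Group) (lam : T -> A) (sig : G -> A),
    (forall x y, lam x = lam y <-> E x y) /\ (forall s, exists x, lam x = s) /\
    (forall g h, S g -> S h -> sig (gmul g h) = gmul (sig g) (sig h)) /\
    (forall g x, S g -> lam (act g x) = gmul (sig g) (lam x)).
Proof.
  intros act1 actM (S1 & SM & SV) Eeq EG Efree Hl. pose proof Eeq as [Er Et Es].
  assert (actV : forall g x, act (ginv g) (act g x) = x)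
    by (intros; now rewrite <- actM, ginv_l).
  (* [R] is the orbit relation on classes of [E]; the list [l'] below keeps one element per orbit,
     and [k] is the number of orbits. *)
  set (R x y := exists g, S g /\ E (act g x) y).
  assert (Req : equivalence T R).
  { split.
    - intros x. exists gone. rewrite act1. auto.
    - intros x y z (g & Sg & Hg) (h & Sh & Hh). exists (gmul h g). split; [auto|].
      rewrite actM. apply Et with (act h y); auto.
    - intros x y (g & Sg & Hg). exists (ginv g). split; [auto|].
      apply Es. rewrite <- (actV g x). auto. }
  destruct (list_transversal R x0 l Req) as (l' & I1 & I2 & I3).
  set (t i := nth i l' x0). set (k := length l') in *.
  assert (Hx : forall x, exists gi : {g | S g} * nat,
    snd gi < k /\ E (act (proj1_sig (fst gi)) (t (snd gi))) x).
  { intros x. destruct (Hl x) as (w & g & Hw & Sg & Hg).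
    destruct (I2 w Hw) as (t0 & Ht0 & h & Sh & Hh).
    apply In_nth with (d := x0) in Ht0 as (i & Hi & <-).
    assert (Sgh : S (gmul g h)) by auto.
    exists (exist _ _ Sgh, i). split; [exact Hi|]. simpl. rewrite actM.
    apply Et with (act g w); auto. }
  assert (kpos : 0 < k) by (destruct (Hx x0) as (gi & H & _); lia).
  (* The first coordinate is an element of [S] up to its action on the classes of [E], the second an
     orbit index modulo [k]. *)
  set (eqv (p q : {g | S g} * nat) :=
    (forall y, E (act (proj1_sig (fst p)) y) (act (proj1_sig (fst q)) y)) /\
    snd p mod k = snd q mod k).
  set (mul (p q : {g | S g} * nat) :=
    (exist S _ (SM _ _ (proj2_sig (fst p)) (proj2_sig (fst q))), snd p + snd q)).
  (* The factor [k - 1] represents -1 modulo [k]. *)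
  set (inv (p : {g | S g} * nat) :=
    (exist S _ (SV _ (proj2_sig (fst p))), (k - 1) * snd p)).
  destruct (quotient_group_exists eqv mul (exist S _ S1, 0) inv)
    as (A & cl & Hs & Hcl & Hm).
  - split.
    + intros p. split; auto.
    + intros p q r [H1 H2] [H3 H4]. split; [intros y; eauto|congruence].
    + intros p q [H1 H2]. split; auto.
  - intros p p' q q' [H1 H2] [H3 H4]. split; simpl.
    + intros y. rewrite !actM. eapply Et; [apply EG, H3; apply proj2_sig|apply H1].
    + rewrite Nat.Div0.add_mod, H2, H4, <- Nat.Div0.add_mod. reflexivity.
  - intros p q r. split; simpl.
    + intros y. rewrite !actM. apply Er.
    + now rewrite Nat.add_assoc.
  - intros p. split; simpl; [|reflexivity]. intros y. rewrite actM, act1. apply Er.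
  - intros p. split; simpl.
    + intros y. rewrite actM, actV, act1. apply Er.
    + replace ((k - 1) * snd p + snd p) with (snd p * k)
        by (destruct k; [lia|simpl; rewrite Nat.sub_0_r; lia]).
      now rewrite Nat.Div0.mod_mul, Nat.Div0.mod_0_l.
  (* Freeness: a class has only one description as the class of [act g (t i)], up to [eqv]. Hence a
     point can be labelled by the pair describing its class. *)
  - assert (U : forall g i h j, S (proj1_sig g) -> i < k -> j < k ->
      E (act (proj1_sig g) (t i)) (act (proj1_sig h) (t j)) -> eqv (g, i) (h, j)).
    { intros [g Sg] i [h Sh] j _ Hi Hj H. simpl in H.
      apply (EG (ginv h)) in H; [|auto]. rewrite actV, <- actM in H.
      assert (i = j) as <-.
      { apply I3; auto. exists (gmul (ginv h) g). auto. }
      split; [|reflexivity]. intros y. simpl. apply Es.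
      assert (K : E y (act (gmul (ginv h) g) y)) by (eapply Efree; eauto).
      apply (EG h) in K; [|assumption].
      now rewrite actM, <- (actM h), ginv_r, act1 in K. }
    apply dependent_choice in Hx as [f Hf].
    (* Elements of [S] have cyclic coordinate 0; outside [S] the value is a default. *)
    set (sig g := match excluded_middle_informative (S g) with
                  | left Sg => cl (exist S g Sg, 0) | right _ => gone end).
    assert (Hsig : forall g (Sg : S g), sig g = cl (exist S g Sg, 0)).
    { intros g Sg. unfold sig. destruct (excluded_middle_informative (S g)) as [Sg'|N];
        [|contradiction]. now rewrite (proof_irrelevance _ Sg Sg'). }
    exists A, (fun x => cl (f x)), sig. repeat split.
    + intros H. apply Hcl in H as [H1 H2].
      destruct (Hf x) as [B1 C1], (Hf y) as [B2 C2].
      rewrite !Nat.mod_small in H2 by assumption. rewrite H2 in C1.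
      eapply Et; [apply Es, C1|]. eapply Et; [apply H1|exact C2].
    + intros H. destruct (Hf x) as [B1 C1], (Hf y) as [B2 C2].
      destruct (f x) as [g i], (f y) as [h j]. simpl in *. apply Hcl, U; auto.
      * apply proj2_sig.
      * eauto.
    + intros s. destruct (Hs s) as [[g i] <-].
      exists (act (proj1_sig g) (t (i mod k))).
      destruct (Hf (act (proj1_sig g) (t (i mod k)))) as [B C].
      destruct (f _) as [h j]. simpl in *.
      assert (Hi : i mod k < k) by (apply Nat.mod_upper_bound; lia).
      apply (U h j g (i mod k)) in C; auto; [|apply proj2_sig].
      apply Hcl. split; [apply C|]. destruct C as [_ C]. simpl in *.
      now rewrite C, Nat.Div0.mod_mod.
    + intros g h Sg Sh. rewrite (Hsig _ Sg), (Hsig _ Sh), (Hsig _ (SM _ _ Sg Sh)), <- Hm.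
      apply Hcl. split; [intros y; apply Er|reflexivity].
    + intros g x Sg. rewrite (Hsig _ Sg), <- Hm. apply Hcl.
      destruct (Hf x) as [B1 C1], (Hf (act g x)) as [B2 C2].
      destruct (f x) as [h i], (f (act g x)) as [h' i']. simpl in *.
      apply (U h' i' (exist S _ (SM _ _ Sg (proj2_sig h))) i); auto.
      * apply proj2_sig.
      * simpl. rewrite actM. apply Et with (act g x); auto.
Qed.

(** * Special actions *)

(** The [translate] by [ginv g], written without an inverse; products therefore act in reversed
    order. *)
Definition pullback {G : Group} {X : SGraph} (act : G -> X -> X) (g : G)
  (J : X -> X -> Prop) : X -> X -> Prop := fun u v => J (act g u) (act g v).

Section Action.
Context {G : Group} {X : SGraph} {act : G -> X -> X} (Hact : is_action act).
Implicit Types (J : X -> X -> Prop) (g h k : G) (x y z : X).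

Lemma act_one x : act gone x = x.
Proof. apply Hact. Qed.

Lemma act_mul g h x : act (gmul g h) x = act g (act h x).
Proof. apply Hact. Qed.

Lemma act_adj g x y : adj x y <-> adj (act g x) (act g y).
Proof. apply Hact. Qed.

Lemma act_invK g x : act (ginv g) (act g x) = x.
Proof. now rewrite <- act_mul, ginv_l, act_one. Qed.

Lemma act_Kinv g x : act g (act (ginv g) x) = x.
Proof. now rewrite <- act_mul, ginv_r, act_one. Qed.

Lemma act_inj g x y : act g x = act g y -> x = y.
Proof. intros E. now rewrite <- (act_invK g x), E, act_invK. Qed.

Lemma act_square g a b c d : square a b c d <-> square (act g a) (act g b) (act g c) (act g d).
Proof.
  unfold square. rewrite <- !(act_adj g).
  assert (K : forall x y, x <> y <-> act g x <> act g y).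
  { intros x y. split; intros N E; apply N; [now apply act_inj in E|now subst]. }
  now rewrite <- !K.
Qed.

Lemma pullback_mul J g h : pullback act (gmul g h) J = pullback act h (pullback act g J).
Proof. extensionality u. extensionality v. unfold pullback. now rewrite !act_mul. Qed.

Lemma pullback_one J : pullback act gone J = J.
Proof. extensionality u. extensionality v. unfold pullback. now rewrite !act_one. Qed.

Lemma pullback_eq_inv J J' g : pullback act g J = J' -> pullback act (ginv g) J' = J.
Proof. intros <-. now rewrite <- pullback_mul, ginv_r, pullback_one. Qed.

(** By [hyp_ind], an automorphism maps a whole hyperplane into the hyperplane containing the image
    of one of its edges. Using this for [g] and for [ginv g] gives equality. *)
Lemma pullback_hyp J g : is_hyperplane J -> is_hyperplane (pullback act g J).
Proof.
  assert (K : forall J g u v, is_hyperplane J -> J u v -> forall J', is_hyperplane J' ->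
            J' (act g u) (act g v) -> forall a b, J a b -> J' (act g a) (act g b)).
  { clear J g. intros J g u v HJ Huv J' HJ' H'.
    apply (hyp_ind J (fun a b => J' (act g a) (act g b)) u v HJ Huv H').
    - intros a b _. now apply hyp_sym.
    - intros a b c _ Hab A B. apply (hyp_triangle J' _ (act g b)); auto.
      + now apply act_adj.
      + now apply act_adj.
    - intros a b a' b' _ Hab S. apply (hyp_square J' (act g a) (act g b)); auto.
      now apply act_square. }
  intros HJ. pose proof HJ as [e0 He0].
  destruct e0 as [[a0 b0] h0].
  assert (H0 : J a0 b0) by (apply He0; exists h0; apply rst_refl).
  assert (A : adj (act (ginv g) a0) (act (ginv g) b0)) by now apply act_adj.
  destruct (hyp_exists _ _ A) as (J' & HJ' & H').
  replace (pullback act g J) with J'; [assumption|].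
  extensionality u. extensionality v. apply propositional_extensionality.
  unfold pullback. split; intro H.
  - apply (K J' g (act (ginv g) a0) (act (ginv g) b0)); auto.
    now rewrite !act_Kinv.
  - rewrite <- (act_invK g u), <- (act_invK g v).
    now apply (K J (ginv g) a0 b0).
Qed.

Lemma pullback_sector J g x y : pullback act g J = J ->
  same_sector J x y -> same_sector J (act g x) (act g y).
Proof.
  intros E [n W]. exists n. induction W as [x|x y z n [A N] W IH]; [constructor|].
  apply rwalkS with (act g y); [|assumption]. split.
  - now apply act_adj.
  - intro H. apply N. rewrite <- E. exact H.
Qed.

Lemma stab_hyp_pullback J g : stab_hyp act J g <-> pullback act g J = J.
Proof.
  split.
  - intros H. apply hyp_ext in H. apply (pullback_eq_inv J J (ginv g)) in H.
    now rewrite ginv_ginv in H.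
  - intros H. apply pullback_eq_inv in H. change (same_hyp (pullback act (ginv g) J) J).
    rewrite H. intros u v. reflexivity.
Qed.

Lemma pullback_stab_subgroup J : is_subgroup (fun g => pullback act g J = J).
Proof.
  repeat split.
  - apply pullback_one.
  - intros g h Hg Hh. now rewrite pullback_mul, Hg.
  - intros g Hg. now apply pullback_eq_inv.
Qed.

(** * Consequences of specialness *)

Section Special.
Context (HX : quasi_median X) (Hspec : special_action act).

(** The vertex [x] lies in the carriers of [J] and of its translate by [ginv g]; distinct translates
    are neither transverse nor tangent, so these two coincide. *)
Lemma special_meet J g x y z : is_hyperplane J -> J x y -> J (act g x) z ->
  pullback act g J = J.
Proof.
  intros HJ H H'. destruct Hspec as [(_ & H1 & _) _].
  apply NNPP. intro N.
  assert (N' : ~ same_hyp (translate act (ginv g) J) J).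
  { intro K. apply hyp_ext in K. apply N. rewrite <- K at 2. unfold translate.
    now rewrite ginv_ginv. }
  destruct (H1 J (ginv g) HJ N') as [T1 T2]. apply T2. split; [|split]; auto.
  - intro K. apply N'. intros u v. symmetry. apply K.
  - exists x. split; [now exists y|]. exists (act (ginv g) z).
    unfold translate. now rewrite ginv_ginv, act_Kinv.
Qed.

Lemma special_not_transverse J g : is_hyperplane J -> ~ transverse J (pullback act g J).
Proof.
  intros HJ T. destruct Hspec as [(_ & H1 & _) _].
  apply (transverse_neq HX _ _ HJ T).
  apply NNPP. intro N. destruct (H1 J (ginv g) HJ) as [K _].
  - intro K. apply N. apply hyp_ext in K. rewrite <- K at 1. unfold translate.
    now rewrite ginv_ginv.
  - apply K. unfold translate. now rewrite ginv_ginv.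
Qed.

(** The carriers of [J1] and of the translate of [J2] meet at [x]; were they not transverse they
    would be tangent, against the second condition of specialness. *)
Lemma special_transverse J1 J2 g x y z : is_hyperplane J1 -> is_hyperplane J2 ->
  transverse J1 J2 -> J1 x y -> J2 (act g x) z -> transverse J1 (pullback act g J2).
Proof.
  intros HJ1 HJ2 T Hx Hz. destruct Hspec as [(_ & _ & H2) _].
  apply NNPP. intro N. apply (H2 J1 J2 (ginv g) HJ1 HJ2 T).
  change (translate act (ginv g) J2) with (pullback act (ginv (ginv g)) J2).
  rewrite ginv_ginv. split; [|split]; auto.
  - intro K. apply hyp_ext in K. symmetry in K. apply pullback_eq_inv in K.
    apply (special_not_transverse J1 (ginv g) HJ1). now rewrite K.
  - exists x. split; [now exists y|]. exists (act (ginv g) z).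
    unfold pullback. now rewrite act_Kinv.
Qed.

Lemma star_sector_eq J x y z : is_hyperplane J ->
  y = x \/ J x y -> z = x \/ J x z -> same_sector J y z -> y = z.
Proof.
  intros HJ Hy Hz Hs. apply NNPP. intro N.
  apply (hyp_separates HX J y z HJ); [|assumption].
  destruct Hy as [->|Hy], Hz as [->|Hz]; try congruence.
  - now apply hyp_sym.
  - apply (hyp_triangle J y x z); auto.
    + now apply hyp_sym.
    + apply (hyp_fan HX J x); auto.
    + apply adj_sym. now apply (hyp_adj J).
Qed.

(** An element fixing [x] preserves the hyperplane of every edge at [x], and by freeness each of its
    sectors. Distinct neighbours along one hyperplane lie in distinct sectors, so all neighbours of
    [x] are fixed; connectedness and faithfulness conclude. *)
Lemma special_free g x : act g x = x -> g = gone.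
Proof.
  intros E. destruct Hspec as [(Hf & _) Hs]. apply Hf.
  assert (K : forall x y, act g x = x -> adj x y -> act g y = y).
  { clear x E. intros x y E A.
    destruct (hyp_exists x y A) as (J & HJ & H).
    assert (P : pullback act g J = J).
    { apply (special_meet J g x y y HJ H). now rewrite E. }
    symmetry. apply (star_sector_eq J x); auto.
    - right. rewrite <- P in H. unfold pullback in H. now rewrite E in H.
    - apply (Hs J HJ).
      + now apply stab_hyp_pullback.
      + exists x. rewrite E. apply same_sector_refl. }
  intros y. destruct (qm_connected HX x y) as [n W].
  induction W as [x|x z y n A W IH]; [assumption|]. apply IH. now apply (K x).
Qed.

Lemma clique_of_star J a b c v : is_hyperplane J -> J a b -> clique_of a b c ->
  (clique_of a b v <-> v = c \/ J c v).
Proof.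
  intros HJ H Hc. pose proof (hyp_adj _ _ _ HJ H) as A. split.
  - intros Hv. destruct (classic (v = c)); [now left|right].
    apply (hyp_clique HX J a b); auto.
  - intros [->|Hv]; [assumption|].
    assert (exists e, clique_of a b e /\ c <> e) as (e & He & N).
    { destruct (classic (c = a)) as [->|N].
      - exists b. split; [right; left; reflexivity|]. intros ->. now apply adj_irrefl in A.
      - exists a. split; [left; reflexivity|assumption]. }
    destruct (classic (v = e)) as [->|N']; [assumption|].
    apply (clique_of_maximal HX a b c e); auto.
    + apply adj_sym. now apply (hyp_adj J).
    + apply (hyp_fan HX J c); auto. now apply (hyp_clique HX J a b).
Qed.

(** Since [c] and [act h c] both lie on edges of [J], [special_meet] shows that [h] preserves [J].
    The clique is the star of either vertex in [J], so [h] preserves it too. *)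
Lemma clique_translate J a b c h : is_hyperplane J -> J a b ->
  clique_of a b c -> clique_of a b (act h c) ->
  pullback act h J = J /\ stab_set act (clique_of a b) h.
Proof.
  intros HJ H Hc Hhc. pose proof (hyp_adj _ _ _ HJ H) as A.
  assert (N : forall c, clique_of a b c -> exists e, J c e).
  { intros c0 Hc0. destruct (classic (c0 = a)) as [->|N]; [now exists b|].
    exists a. apply (hyp_clique HX J a b); auto. left; reflexivity. }
  destruct (N c Hc) as [e He], (N _ Hhc) as [e' He'].
  assert (P : pullback act h J = J) by now apply (special_meet J h c e e').
  split; [assumption|]. intros v.
  rewrite (clique_of_star J a b c v HJ H Hc), (clique_of_star J a b _ _ HJ H Hhc).
  change (J (act h c) (act h v)) with (pullback act h J c v). rewrite P.
  split; intros [E|E]; auto.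
  - left. now apply act_inj in E.
  - left. now rewrite E.
Qed.

Lemma stab_clique_pullback J a b h : is_hyperplane J -> J a b ->
  stab_set act (clique_of a b) h -> pullback act h J = J.
Proof.
  intros HJ H S. assert (Ha : clique_of a b a) by (left; reflexivity).
  apply (clique_translate J a b a h); auto. now apply S.
Qed.

Context (Hfin : finitely_many_vertex_orbits act).

(** The representatives are moved into [C] itself, so that for a clique dual to a hyperplane
    [clique_translate] puts the connecting elements [h] in its stabiliser. *)
Lemma finitely_many_orbits_in (C : X -> Prop) : exists L : list X,
  (forall t, In t L -> C t) /\
  forall c, C c -> exists t h, In t L /\ act h t = c.
Proof.
  destruct Hfin as [l Hl].
  assert (K : exists L : list X, (forall t, In t L -> C t) /\
    forall w g, In w l -> C (act g w) -> exists t k, In t L /\ t = act k w).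
  { clear Hl. induction l as [|w l (L & L1 & L2)].
    - exists nil. split; intros; contradiction.
    - destruct (classic (exists g, C (act g w))) as [[g Hg]|N].
      + exists (act g w :: L)%list. split.
        * intros t [<-|Ht]; auto.
        * intros w' g' [<-|Hw] Hg'.
          -- exists (act g w), g. split; [left|]; reflexivity.
          -- destruct (L2 w' g' Hw Hg') as (t & k & Ht & E).
             exists t, k. split; [right|]; assumption.
      + exists L. split; [assumption|]. intros w' g' [<-|Hw] Hg'; [|eauto].
        exfalso. eauto. }
  destruct K as (L & L1 & L2). exists L. split; [assumption|].
  intros c Hc. destruct (Hl c) as (w & g & Hw & ->).
  destruct (L2 w g Hw Hc) as (t & k & Ht & ->).
  exists (act k w), (gmul g (ginv k)). split; [assumption|].
  now rewrite act_mul, act_invK.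
Qed.

(** The stabiliser of [J] acts freely on the sectors, and with finitely many orbits because every
    sector meets the clique [C]. The subgroup of [A] is the image of the stabiliser of [C] under
    [sig]. *)
Lemma sector_group_exists J : is_hyperplane J ->
  exists (A : Group) (lam : X -> A),
    (forall x y, lam x = lam y <-> same_sector J x y) /\
    (forall s, exists x, lam x = s) /\
    (forall g, pullback act g J = J ->
       exists s, forall x, lam (act g x) = gmul s (lam x)) /\
    nontrivial_group A /\
    exists (C : X -> Prop) (H : A -> Prop),
      is_clique C /\ is_subgroup H /\ finite_index H /\
      subgroups_isomorphic H (stab_set act C).
Proof.
  intros HJ. pose proof HJ as [[[a b] h0] He0].
  assert (H : J a b) by (apply He0; exists h0; apply rst_refl). clear He0.
  destruct (finitely_many_orbits_in (clique_of a b)) as (L & L1 & L2).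
  set (S g := pullback act g J = J).
  assert (HS : is_subgroup S) by apply pullback_stab_subgroup.
  assert (Heq : equivalence X (same_sector J)).
  { split.
    - intros x. apply same_sector_refl.
    - intros x y z. apply same_sector_trans.
    - intros x y. now apply same_sector_sym. }
  destruct (simply_transitive_extension act S (same_sector J) a L)
    as (A & lam & sig & Hlam & Hsurj & Hsig & Hequ); auto.
  - apply act_one.
  - apply act_mul.
  - intros g x y Sg. now apply pullback_sector.
  - intros g x y Sg K. apply (proj2 Hspec J HJ g); [now apply stab_hyp_pullback|eauto].
  - intros x. destruct (every_sector_meets_clique HX J x a b HJ H) as (c & Hc & Hxc).
    destruct (L2 c Hc) as (t & h & Ht & <-). exists t, h. split; [assumption|].
    split; [|now apply same_sector_sym].
    apply (clique_translate J a b t h); auto.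
  - exists A, lam. split; [assumption|]. split; [assumption|]. split.
    { intros g Sg. exists (sig g). intros x. now apply Hequ. }
    split.
    { apply NNPP. intro N. apply (hyp_separates HX J a b HJ H). apply Hlam.
      assert (forall s : A, s = gone) as K.
      { intros s. apply NNPP. intro. apply N. now exists s. }
      now rewrite (K (lam a)), (K (lam b)). }
    set (C := clique_of a b).
    assert (Stab : forall g, stab_set act C g -> S g)
      by (intros g; now apply stab_clique_pullback).
    assert (St1 : stab_set act C gone) by (intros v; now rewrite act_one).
    assert (StM : forall g h, stab_set act C g -> stab_set act C h ->
                    stab_set act C (gmul g h)).
    { intros g h Hg Hh v. rewrite act_mul, (Hg (act h v)). apply Hh. }
    assert (StV : forall g, stab_set act C g -> stab_set act C (ginv g)).
    { intros g Hg v. rewrite <- (Hg (act (ginv g) v)), act_Kinv. reflexivity. }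
    assert (sig1 : sig gone = gone).
    { apply gmul_idem. rewrite <- Hsig, gone_l; auto; apply HS. }
    assert (sigV : forall g, S g -> sig (ginv g) = ginv (sig g)).
    { intros g Sg. apply ginv_unique. rewrite <- Hsig, ginv_r; auto. now apply HS. }
    (* If [sig g = sig h], then [gmul (ginv h) g] preserves both [C] and the sector of [a], hence
       fixes [a], and the action on vertices is free. *)
    assert (siginj : forall g h, stab_set act C g -> stab_set act C h ->
                       sig g = sig h -> g = h).
    { intros g h Hg Hh E.
      assert (Ca : C a) by (left; reflexivity).
      assert (K : act (gmul (ginv h) g) a = a).
      { apply (star_sector_eq J a); auto.
        - apply (clique_of_star J a b a); auto. apply StM; auto.
        - apply Hlam. rewrite Hequ by (apply Stab; auto).
          rewrite Hsig, sigV, E, ginv_l, gone_l; auto. }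
      apply special_free in K. apply (gcancel_l (ginv h)). now rewrite K, ginv_l. }
    exists C, (fun s => exists g, stab_set act C g /\ sig g = s).
    split; [now apply (clique_of_is_clique HX), (hyp_adj J)|]. split; [|split].
    + repeat split.
      * now exists gone.
      * intros s s' (g & Hg & <-) (g' & Hg' & <-). exists (gmul g g').
        split; [auto|]. now rewrite Hsig by auto.
      * intros s (g & Hg & <-). exists (ginv g). split; auto.
    (* Some [act h t] in the clique has label [ginv s], so [sig h] times [lam t] is [ginv s], and
       [gmul (lam t) s] equals [sig (ginv h)]. *)
    + exists (map (fun t => ginv (lam t)) L). intros s.
      destruct (Hsurj (ginv s)) as [x Hx].
      destruct (every_sector_meets_clique HX J x a b HJ H) as (c & Hc & Hxc).
      apply Hlam in Hxc. destruct (L2 c Hc) as (t & h & Ht & <-).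
      assert (Hh : S h /\ stab_set act C h) by (apply (clique_translate J a b t h); auto).
      exists (ginv (lam t)). split; [apply (in_map (fun t => ginv (lam t))), Ht|].
      exists (ginv h). split; [now apply StV|].
      rewrite sigV by apply Hh. rewrite ginv_ginv. symmetry.
      apply ginv_unique. apply (gcancel_r (ginv s)).
      rewrite gone_l, <- !gassoc, ginv_r, gone_r.
      rewrite <- Hx, Hxc. symmetry. now apply Hequ.
    (* The isomorphism [f] inverts [sig] on its image and has the default value [gone] elsewhere. *)
    + destruct (dependent_choice (fun (s : A) (g : G) =>
        (exists g', stab_set act C g' /\ sig g' = s) -> stab_set act C g /\ sig g = s))
        as [f Hf].
      { intros s. destruct (classic (exists g', stab_set act C g' /\ sig g' = s))
          as [[g Hg]|N]; [now exists g|]. exists gone. contradiction. }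
      exists f. split; [|split; [|split]].
      * intros s Hs. now apply Hf.
      * intros s s' Hs Hs' E. rewrite <- (proj2 (Hf s Hs)), E. now apply Hf.
      * intros g Hg. exists (sig g). assert (Hs : exists g', stab_set act C g' /\ sig g' = sig g) by eauto.
        split; [assumption|]. apply siginj; auto; now apply Hf.
      * intros s s' Hs Hs'. destruct (Hf s Hs) as [K1 K2], (Hf s' Hs') as [K3 K4].
        apply siginj; auto.
        -- apply Hf. exists (gmul (f s) (f s')). split; auto. rewrite Hsig; auto. now rewrite K2, K4.
        -- rewrite Hsig, K2, K4; auto. apply Hf.
           exists (gmul (f s) (f s')). split; auto. rewrite Hsig; auto. now rewrite K2, K4.
Qed.
End Special.
End Action.

(** * Edge labellings *)

(** Labels are multiplied along geodesics from [x0], and independence of the geodesic is proved by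
    induction on the distance: two predecessors of a vertex either are adjacent and form a triangle
    with it, or complete to a square by the quadrangle condition. *)
Lemma potential_exists {X : SGraph} (HX : quasi_median X) (P : Group)
  (lab : X -> X -> P) (x0 : X) :
  (forall x y, adj x y -> gmul (lab x y) (lab y x) = gone) ->
  (forall x y z, adj x y -> adj y z -> adj x z -> lab x z = gmul (lab x y) (lab y z)) ->
  (forall a b c d, square a b c d ->
     gmul (lab a b) (lab b c) = gmul (lab a d) (lab d c)) ->
  exists phi : X -> P, phi x0 = gone /\ forall x y, adj x y -> phi y = gmul (phi x) (lab x y).
Proof.
  intros Linv Ltri Lsq. pose proof (qm_connected HX) as conn.
  (* For [x] at distance [n] from [x0], [geo n x p] says that [p] is the product of the labels along
     some geodesic from [x0] to [x]. *)
  set (geo := fix geo n x p := match n with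
    | 0 => x = x0 /\ p = gone
    | S n => exists y q, adj y x /\ gdist x0 y = n /\ geo n y q /\ p = gmul q (lab y x)
    end).
  assert (Ex : forall n x, gdist x0 x = n -> exists p, geo n x p).
  { induction n as [|n IH]; intros x E.
    - exists gone. split; [|reflexivity]. symmetry. now apply (gdist_eq0 conn).
    - destruct (gdist_pred conn _ _ _ E) as (y & Ay & Ey).
      destruct (IH y Ey) as [q Hq]. exists (gmul q (lab y x)), y, q. auto. }
  (* Edges between equidistant vertices, handled by the triangle condition; uniqueness at level [n]
     is a premise because the induction for [Un] uses [Level] at the preceding level. *)
  assert (Level : forall n,
    (forall x p p', gdist x0 x = n -> geo n x p -> geo n x p' -> p = p') ->
    forall x y p q, adj x y -> gdist x0 x = n -> gdist x0 y = n ->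
      geo n x p -> geo n y q -> q = gmul p (lab x y)).
  { intros n Un x y p q A E E' Gp Gq.
    destruct (qm_triangle HX x0 x y A) as (z & Z1 & Z2 & Z3); [congruence|].
    destruct n as [|n]; [lia|].
    assert (Ez : gdist x0 z = n) by lia.
    destruct (Ex n z Ez) as [r Hr].
    rewrite (Un x p (gmul r (lab z x))); [|assumption|assumption|exists z, r; auto].
    rewrite (Un y q (gmul r (lab z y))); [|assumption|assumption|exists z, r; auto].
    now rewrite (Ltri z x y), gassoc. }
  assert (Un : forall n x p p', gdist x0 x = n -> geo n x p -> geo n x p' -> p = p').
  { induction n as [|n IH]; intros x p p' E Gp Gp'.
    - destruct Gp as [_ ->], Gp' as [_ ->]. reflexivity.
    - destruct Gp as (y & q & Ay & Ey & Gq & ->), Gp' as (y' & q' & Ay' & Ey' & Gq' & ->).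
      destruct (classic (y = y')) as [<-|N]; [now rewrite (IH y q q')|].
      destruct (classic (adj y y')) as [A|A].
      + rewrite (Level n IH y y' q q'); auto.
        now rewrite (Ltri y y' x), gassoc.
      + destruct (qm_quadrangle HX x0 y y' x) as (w & W1 & W2 & W3);
          auto using adj_sym; try lia.
        destruct n as [|n]; [lia|].
        assert (Ew : gdist x0 w = n) by lia.
        destruct (Ex n w Ew) as [r Hr].
        rewrite (IH y q (gmul r (lab w y))); [|assumption|assumption|exists w, r; auto].
        rewrite (IH y' q' (gmul r (lab w y'))); [|assumption|assumption|exists w, r; auto].
        rewrite <- !gassoc, (Lsq w y x y'); [reflexivity|].
        repeat split; auto using adj_sym.
        * intros ->. lia.
        * intro K. pose proof (gdist_adj_le conn x0 _ _ K). lia. }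
  destruct (dependent_choice (fun x p => geo (gdist x0 x) x p)) as [phi Hphi].
  { intros x. now apply Ex. }
  assert (Up : forall x y, adj x y -> gdist x0 y = S (gdist x0 x) ->
                 phi y = gmul (phi x) (lab x y)).
  { intros x y A E. apply (Un (gdist x0 y) y); auto. rewrite E. exists x, (phi x). auto. }
  exists phi. split.
  - apply (Un 0 x0); [apply (gdist_refl conn)| |split; reflexivity].
    rewrite <- (gdist_refl conn x0) at 1. apply Hphi.
  - intros x y A. pose proof (gdist_adj_le conn x0 _ _ A).
    pose proof (gdist_adj_le conn x0 _ _ (adj_sym _ _ _ A)).
    assert (gdist x0 y = S (gdist x0 x) \/ gdist x0 x = S (gdist x0 y) \/
            gdist x0 x = gdist x0 y) as [E|[E|E]] by lia.
    + auto.
    + rewrite (Up y x), <- gassoc, Linv, gone_r; auto using adj_sym.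
    + apply (Level _ (Un (gdist x0 x))); auto. rewrite E. apply Hphi.
Qed.

Lemma transverse_sym {X : SGraph} (J1 J2 : X -> X -> Prop) :
  is_hyperplane J1 -> is_hyperplane J2 -> transverse J1 J2 -> transverse J2 J1.
Proof.
  intros H1 H2 (a & b & c & d & S & A & B). exists c, b, a, d.
  split; [now apply square_flip, square_transpose, square_flip|].
  split; now apply hyp_sym.
Qed.

(** * Orbits of hyperplanes and the crossing graph *)

Section HyperplaneOrbits.
Context {G : Group} {X : SGraph} {act : G -> X -> X} (Hact : is_action act).
Context (HX : quasi_median X) (Hspec : special_action act).

Lemma transverse_pullback J1 J2 g :
  transverse J1 J2 -> transverse (pullback act g J1) (pullback act g J2).
Proof.
  intros (a & b & c & d & S & A & B).
  exists (act (ginv g) a), (act (ginv g) b), (act (ginv g) c), (act (ginv g) d).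
  unfold pullback. rewrite !(act_Kinv Hact). split; [now apply (act_square Hact)|auto].
Qed.

Lemma hyperplane_orbits_exist : exists (Q : Type) (Jr : Q -> X -> X -> Prop),
  (forall u, is_hyperplane (Jr u)) /\
  (forall u v g, pullback act g (Jr u) = Jr v -> u = v) /\
  (forall J, is_hyperplane J -> exists u g, J = pullback act g (Jr u)).
Proof.
  set (R (J J' : {J : X -> X -> Prop | is_hyperplane J}) :=
    exists g, pullback act g (proj1_sig J) = proj1_sig J').
  destruct (quotient_exists R) as (Q & cl & Hs & Hcl).
  { split.
    - intros J. exists gone. apply (pullback_one Hact).
    - intros J1 J2 J3 [g Hg] [h Hh]. exists (gmul g h).
      now rewrite (pullback_mul Hact), Hg.
    - intros J1 J2 [g Hg]. exists (ginv g). now apply (pullback_eq_inv Hact). }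
  apply dependent_choice in Hs as [rep Hrep].
  exists Q, (fun u => proj1_sig (rep u)). split; [|split].
  - intros u. apply proj2_sig.
  - intros u v g E. rewrite <- (Hrep u), <- (Hrep v). apply Hcl. now exists g.
  - intros J HJ. destruct (proj1 (Hcl _ _) (Hrep (cl (exist _ J HJ)))) as [g E].
    exists (cl (exist _ J HJ)), g. now rewrite E.
Qed.

Context {Q : Type} {Jr : Q -> X -> X -> Prop} (HJr : forall u, is_hyperplane (Jr u)).
Context (Jr_orbit : forall u v g, pullback act g (Jr u) = Jr v -> u = v).

Definition crossing_graph : SGraph.
Proof.
  exists Q (fun u v => exists g, transverse (Jr u) (pullback act g (Jr v))).
  - intros u v [g T]. exists (ginv g).
    apply transverse_sym in T; [|apply HJr|now apply (pullback_hyp Hact)].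
    apply (transverse_pullback _ _ (ginv g)) in T.
    now rewrite (pullback_eq_inv Hact (Jr v) _ g eq_refl) in T.
  - intros u [g T]. exact (special_not_transverse HX Hspec (Jr u) g (HJr u) T).
Defined.

(** * The right action on vertices *)

Context {A : Q -> Group} {lam : forall u, X -> A u}.
Context (lam_sector : forall u x y, lam u x = lam u y <-> same_sector (Jr u) x y).
Context (lam_surj : forall u s, exists x, lam u x = s).
Context (lam_equiv : forall u g, pullback act g (Jr u) = Jr u ->
  exists s, forall x, lam u (act g x) = gmul s (lam u x)).

(* The right action of the vertex groups on the vertices of [X]: [s : A u] moves [x]
   inside the clique at [x] dual to a hyperplane of the orbit [u] (there is at most one)
   according to the labels, and fixes [x] if there is no such clique. *)
Definition move (u : Q) (s : A u) (x y : X) : Prop :=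
  (exists g w, Jr u (act g x) w /\ (y = x \/ Jr u (act g x) (act g y)) /\
     lam u (act g y) = gmul (lam u (act g x)) s) \/
  (~ (exists g w, Jr u (act g x) w) /\ y = x).

(** By [special_meet], only one hyperplane of the orbit [u] passes through [x]. Conditions tested
    with one [g] can thus be tested with any other. *)
Lemma carrier_translates u g h x w w' : Jr u (act g x) w -> Jr u (act h x) w' ->
  pullback act (gmul h (ginv g)) (Jr u) = Jr u.
Proof.
  intros H H'. apply (special_meet Hact Hspec (Jr u) _ (act g x) w w' (HJr u) H).
  now rewrite (act_mul Hact), (act_invK Hact).
Qed.

Lemma Jr_change u g h x y z w w' : Jr u (act g x) w -> Jr u (act h x) w' ->
  Jr u (act g y) (act g z) -> Jr u (act h y) (act h z).
Proof.
  intros H H' K. pose proof (carrier_translates u g h x w w' H H') as P.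
  rewrite <- P in K. unfold pullback in K.
  now rewrite !(act_mul Hact), !(act_invK Hact) in K.
Qed.

(** The stabiliser of [Jr u] multiplies labels on the left, so the right quotient [s] of two labels
    does not depend on the translating element. *)
Lemma lam_change u g h x y z s w w' : Jr u (act g x) w -> Jr u (act h x) w' ->
  lam u (act g z) = gmul (lam u (act g y)) s -> lam u (act h z) = gmul (lam u (act h y)) s.
Proof.
  intros H H' K. pose proof (carrier_translates u g h x w w' H H') as P.
  apply lam_equiv in P as [t Ht].
  assert (E : forall v, lam u (act h v) = gmul t (lam u (act g v))).
  { intros v. rewrite <- Ht. now rewrite (act_mul Hact), (act_invK Hact). }
  now rewrite !E, K, gassoc.
Qed.

Lemma move_carrier u s x y g w : move u s x y -> Jr u (act g x) w ->
  (y = x \/ Jr u (act g x) (act g y)) /\ lam u (act g y) = gmul (lam u (act g x)) s.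
Proof.
  intros [(h & w' & H1 & H2 & H3)|[N _]] H; [|exfalso; eauto].
  split.
  - destruct H2 as [->|H2]; [now left|right]. now apply (Jr_change u h g x x y w' w).
  - now apply (lam_change u h g x x y s w' w).
Qed.

Lemma move_total u s x : exists y, move u s x y.
Proof.
  destruct (classic (exists g w, Jr u (act g x) w)) as [(g & w & H)|N].
  - destruct (lam_surj u (gmul (lam u (act g x)) s)) as [z Hz].
    destruct (every_sector_meets_clique HX (Jr u) z _ _ (HJr u) H) as (c & Hc & Hzc).
    apply lam_sector in Hzc. exists (act (ginv g) c). left. exists g, w.
    rewrite (act_Kinv Hact). split; [assumption|]. split; [|congruence].
    apply (clique_of_star HX (Jr u) _ w (act g x)) in Hc; auto; [|left; reflexivity].
    destruct Hc as [->|Hc]; [left; apply (act_invK Hact)|now right].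
  - exists x. now right.
Qed.

Lemma move_unique u s x y y' : move u s x y -> move u s x y' -> y = y'.
Proof.
  intros H H'. destruct (classic (exists g w, Jr u (act g x) w)) as [(g & w & K)|N].
  - destruct (move_carrier u s x y g w H K) as [H1 H2].
    destruct (move_carrier u s x y' g w H' K) as [H3 H4].
    apply (act_inj Hact g). apply (star_sector_eq HX (Jr u) (act g x)); auto.
    + destruct H1 as [->|H1]; auto.
    + destruct H3 as [->|H3]; auto.
    + apply lam_sector. congruence.
  - destruct H as [(g & w & H & _)|[_ ->]]; [exfalso; eauto|].
    destruct H' as [(g & w & H & _)|[_ ->]]; [exfalso; eauto|]. reflexivity.
Qed.

Lemma move_one u x : move u gone x x.
Proof.
  destruct (classic (exists g w, Jr u (act g x) w)) as [(g & w & K)|N].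
  - left. exists g, w. rewrite gone_r. auto.
  - now right.
Qed.

Lemma move_mul u s t x y z : move u s x y -> move u t y z -> move u (gmul s t) x z.
Proof.
  intros [(g & w & H1 & H2 & H3)|[N ->]] H.
  - assert (exists w', Jr u (act g y) w') as [w' Hw'].
    { destruct H2 as [->|H2]; [now exists w|]. exists (act g x). apply hyp_sym; auto. }
    destruct (move_carrier u t y z g w' H Hw') as [H4 H5].
    left. exists g, w. split; [assumption|]. split; [|now rewrite H5, H3, gassoc].
    destruct H2 as [->|H2]; [assumption|].
    destruct H4 as [->|H4]; [now right|].
    destruct (classic (z = x)) as [->|N]; [now left|right].
    assert (Jyx : Jr u (act g y) (act g x)) by (apply hyp_sym; auto).
    apply hyp_triangle with (v := act g y); auto.
    + apply (hyp_fan HX (Jr u) (act g y)); auto. intro E. now apply (act_inj Hact) in E.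
    + apply adj_sym, (hyp_adj (Jr u)); auto.
  - destruct H as [(g & w & H & _)|[_ ->]]; [exfalso; eauto|]. now right.
Qed.

Lemma move_equivariant u s h x y : move u s x y -> move u s (act h x) (act h y).
Proof.
  assert (K : forall g v, act (gmul g (ginv h)) (act h v) = act g v)
    by (intros; now rewrite (act_mul Hact), (act_invK Hact)).
  intros [(g & w & H1 & H2 & H3)|[N ->]].
  - left. exists (gmul g (ginv h)), w. rewrite !K. split; [assumption|]. split; auto.
    destruct H2 as [->|H2]; auto.
  - right. split; [|reflexivity]. intros (g & w & H). apply N.
    exists (gmul g h), w. now rewrite (act_mul Hact).
Qed.

Lemma lam_same_side u g x y z w : square x y w z -> Jr u (act g x) (act g y) ->
  lam u (act g z) = lam u (act g x) /\ lam u (act g w) = lam u (act g y) /\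
  Jr u (act g z) (act g w).
Proof.
  intros S H. apply (act_square Hact g) in S. split; [|split].
  - apply lam_sector. apply same_sector_sym; auto. apply same_sector_edge.
    + apply adj_sym. apply S.
    + now apply (square_sides HX (Jr u) _ (act g y) _ (act g w)).
  - apply lam_sector. apply same_sector_sym; auto. apply same_sector_edge.
    + apply S.
    + apply (square_sides HX (Jr u) _ (act g x) _ (act g z)); auto.
      * now apply hyp_sym.
      * now apply square_flip.
  - now apply (hyp_square (Jr u) (act g x) (act g y)).
Qed.

(** Adjacency only provides some transverse pair of representatives; [special_transverse] passes to
    the translates meeting at [x], and [transverse_square] then completes the two edges. *)
Lemma crossing_square (u v : crossing_graph) g h x y z : adj u v ->
  Jr u (act g x) (act g y) -> Jr v (act h x) (act h z) -> exists w, square x y w z.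
Proof.
  intros [k T] Hu Hv.
  set (J2 := pullback act k (Jr v)) in *.
  assert (HJ2 : is_hyperplane J2) by (apply (pullback_hyp Hact); auto).
  (* Chosen so that, on [g]-translated vertices, the hyperplane [pullback act m J2] reads as [Jr v]
     on [h]-translated ones. *)
  set (m := gmul (ginv k) (gmul h (ginv g))).
  assert (Hm : forall a b, pullback act m J2 (act g a) (act g b) = Jr v (act h a) (act h b)).
  { intros a b. unfold pullback, J2, m.
    unfold pullback. now rewrite !(act_mul Hact), !(act_Kinv Hact), !(act_invK Hact). }
  assert (Hz : pullback act m J2 (act g x) (act g z)) by now rewrite Hm.
  assert (T' : transverse (Jr u) (pullback act m J2))
    by (apply (special_transverse Hact HX Hspec _ _ m (act g x) (act g y) (act m (act g z)));
        auto).
  destruct (transverse_square HX _ _ (act g x) (act g y) (act g z) (HJr u)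
              (pullback_hyp Hact J2 m HJ2) T' Hu Hz) as [w S].
  exists (act (ginv g) w). apply (act_square Hact g). now rewrite (act_Kinv Hact).
Qed.

(** A move along [v] cannot reach a carrier of the orbit [u] from outside: the square at [z] would
    bring an edge of that hyperplane back to [x]. *)
Lemma move_commute_off (u v : crossing_graph) (s : A u) (t : A v) x z : adj u v ->
  ~ (exists g w, Jr u (act g x) w) -> move v t x z -> move u s z z.
Proof.
  intros Huv N H. destruct H as [(h & w & H1 & [->|H2] & _)|[_ ->]]; [now right| |now right].
  right. split; [|reflexivity]. intros (g & p & Hp). apply N.
  assert (Hp' : Jr u (act g z) (act g (act (ginv g) p))) by now rewrite (act_Kinv Hact).
  assert (Hz : Jr v (act h z) (act h x)) by (apply hyp_sym; auto).
  destruct (crossing_square u v g h z _ x Huv Hp' Hz) as [q S].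
  destruct (lam_same_side u g _ _ _ _ S Hp') as (_ & _ & K). eauto.
Qed.

(** When both moves displace [x], the two edges span a square whose fourth vertex is the common end;
    opposite sides carry the same labels. Otherwise one of the moves is trivial. *)
Lemma move_commute (u v : crossing_graph) (s : A u) (t : A v) x y z : adj u v ->
  move u s x y -> move v t x z -> exists w, move v t y w /\ move u s z w.
Proof.
  intros Huv Hy Hz. pose proof (adj_sym _ _ _ Huv) as Hvu.
  destruct (classic (exists g w, Jr u (act g x) w)) as [(g & p & Hp)|N].
  2: { pose proof Hy as [(g & p & Hp & _)|[_ ->]]; [exfalso; eauto|].
       exists z. split; [assumption|]. eapply move_commute_off; eauto. }
  destruct (classic (exists h w, Jr v (act h x) w)) as [(h & q & Hq)|N].
  2: { pose proof Hz as [(h & q & Hq & _)|[_ ->]]; [exfalso; eauto|].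
       exists y. split; [|assumption]. eapply (move_commute_off v u); eauto. }
  destruct (move_carrier u s x y g p Hy Hp) as [[->|Ky] Ly].
  { assert (s = gone) as ->.
    { apply (gcancel_l (lam u (act g x))). now rewrite gone_r. }
    exists z. split; [assumption|apply move_one]. }
  destruct (move_carrier v t x z h q Hz Hq) as [[->|Kz] Lz].
  { assert (t = gone) as ->.
    { apply (gcancel_l (lam v (act h x))). now rewrite gone_r. }
    exists y. split; [apply move_one|assumption]. }
  destruct (crossing_square u v g h x y z Huv Ky Kz) as [w S].
  destruct (lam_same_side u g x y z w S Ky) as (E1 & E2 & K1).
  destruct (lam_same_side v h x z y w (square_transpose _ _ _ _ S) Kz) as (E3 & E4 & K2).
  exists w. split; left.
  - exists h, (act h w). rewrite E3, E4. auto.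
  - exists g, (act g w). rewrite E1, E2. auto.
Qed.

Context {P : Group} {iota : forall u : crossing_graph, A u -> P}.
Context (Pgp : @is_graph_product crossing_graph A P iota).

Lemma right_action_exists : exists ra : X -> P -> X,
  (forall x, ra x gone = x) /\
  (forall x p q, ra x (gmul p q) = ra (ra x p) q) /\
  (forall g x p, act g (ra x p) = ra (act g x) p) /\
  (forall u s x, move u s x (ra x (iota u s))).
Proof.
  destruct (equivariant_permutations_exist act) as (Q0 & ev & evM & evE & evG & evS).
  assert (H : forall u, exists phi : A u -> Q0, forall s x, move u s x (ev x (phi s))).
  { intros u. apply (dependent_choice (fun s q => forall x, move u s x (ev x q))).
    intros s.
    (* Moving by [s] is a permutation whose inverse is moving by [ginv s]; it commutes with [G] by
       uniqueness of moves. *)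
    destruct (dependent_choice (move u s) (move_total u s)) as [f Hf].
    destruct (dependent_choice (move u (ginv s)) (move_total u (ginv s))) as [f' Hf'].
    destruct (evS f f') as [q Hq].
    - intros x. apply (move_unique u gone x); [|apply move_one].
      rewrite <- (ginv_l _ s). eapply move_mul; eauto.
    - intros x. apply (move_unique u gone x); [|apply move_one].
      rewrite <- (ginv_r s). eapply move_mul; eauto.
    - intros g x. apply (move_unique u s (act g x)); [|apply Hf].
      apply move_equivariant, Hf.
    - exists q. intros x. now rewrite Hq. }
  apply dependent_choice in H as [phi Hphi].
  destruct Pgp as (_ & _ & univ).
  destruct (univ Q0 phi) as [(R & Rhom & HR) _].
  - intros u s t. apply evE. intros x. apply (move_unique u (gmul s t) x); [apply Hphi|].
    rewrite evM. eapply move_mul; apply Hphi.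
  - intros u v s t Huv. apply evE. intros x. rewrite !evM.
    destruct (move_commute u v s t x _ _ Huv (Hphi u s x) (Hphi v t x)) as (w & W1 & W2).
    rewrite (move_unique v t _ _ w (Hphi v t _) W1).
    now rewrite (move_unique u s _ _ w (Hphi u s _) W2).
  - exists (fun x p => ev x (R p)). split; [|split; [|split]].
    + intros x. rewrite (hom_one R Rhom).
      destruct (evS (fun x => x) (fun x => x)) as [e He]; auto.
      rewrite <- (gmul_idem e); [apply He|]. apply evE. intros y. now rewrite evM, !He.
    + intros x p q. now rewrite Rhom, evM.
    + intros g x p. apply evG.
    + intros u s x. rewrite HR. apply Hphi.
Qed.

(** * Labels of edges *)

Context (Jr_all : forall J, is_hyperplane J -> exists u g, J = pullback act g (Jr u)).

Definition edge_label (x y : X) (p : P) : Prop :=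
  exists u (s : A u) g, Jr u (act g x) (act g y) /\
    lam u (act g y) = gmul (lam u (act g x)) s /\ p = iota u s.

Lemma edge_label_exists x y : adj x y -> exists p, edge_label x y p.
Proof.
  intros H. destruct (hyp_exists x y H) as (J & HJ & Hxy).
  destruct (Jr_all J HJ) as (u & g & ->).
  exists (iota u (gmul (ginv (lam u (act g x))) (lam u (act g y)))).
  exists u, (gmul (ginv (lam u (act g x))) (lam u (act g y))), g.
  split; [exact Hxy|]. split; [|reflexivity].
  now rewrite gassoc, ginv_r, gone_l.
Qed.

Lemma edge_label_unique x y p q : edge_label x y p -> edge_label x y q -> p = q.
Proof.
  intros (u & s & g & H1 & H2 & ->) (v & t & h & H3 & H4 & ->).
  assert (u = v) as <-.
  { apply (Jr_orbit u v (gmul g (ginv h))). rewrite (pullback_mul Hact).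
    assert (E : pullback act g (Jr u) = pullback act h (Jr v)).
    { apply (hyp_unique _ _ x y); auto; apply (pullback_hyp Hact); auto. }
    rewrite E. now apply (pullback_eq_inv Hact). }
  f_equal. apply (gcancel_l (lam u (act h x))). rewrite <- H4. symmetry.
  now apply (lam_change u g h x x y s (act g y) (act h y)).
Qed.

Lemma edge_label_equivariant h x y p :
  edge_label x y p -> edge_label (act h x) (act h y) p.
Proof.
  intros (u & s & g & H1 & H2 & ->). exists u, s, (gmul g (ginv h)).
  rewrite !(act_mul Hact), !(act_invK Hact). auto.
Qed.

Lemma edge_label_move x y p : edge_label x y p -> exists u s, move u s x y /\ p = iota u s.
Proof.
  intros (u & s & g & H1 & H2 & ->). exists u, s. split; [|reflexivity].
  left. exists g, (act g y). auto.
Qed.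

Lemma edge_label_inv x y p q : edge_label x y p -> edge_label y x q -> gmul p q = gone.
Proof.
  intros (u & s & g & H1 & H2 & ->) Hq.
  assert (K : edge_label y x (iota u (ginv s))).
  { exists u, (ginv s), g. split; [apply hyp_sym; auto|]. split; [|reflexivity].
    now rewrite H2, <- gassoc, ginv_r, gone_r. }
  rewrite (edge_label_unique _ _ _ _ Hq K).
  destruct Pgp as (Hh & _). rewrite <- (Hh u), ginv_r. now apply hom_one.
Qed.

Lemma edge_label_triangle x y z p q : adj x z ->
  edge_label x y p -> edge_label y z q -> edge_label x z (gmul p q).
Proof.
  intros Axz (u & s & g & H1 & H2 & ->) Hq.
  assert (Hyz : Jr u (act g y) (act g z) /\ Jr u (act g x) (act g z)).
  { assert (Ayz : adj y z).
    { destruct Hq as (v & t & h & Hq & _). apply (act_adj Hact h).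
      now apply (hyp_adj (Jr v)). }
    assert (A1 : adj (act g z) (act g y)) by (apply (act_adj Hact); now apply adj_sym).
    assert (A2 : adj (act g z) (act g x)) by (apply (act_adj Hact); now apply adj_sym).
    split.
    - apply (hyp_triangle (Jr u) _ (act g x)); auto. apply hyp_sym; auto.
    - apply (hyp_triangle (Jr u) _ (act g y)); auto. }
  destruct Hyz as [Hyz Hxz].
  set (t := gmul (ginv (lam u (act g y))) (lam u (act g z))).
  assert (Ht : lam u (act g z) = gmul (lam u (act g y)) t)
    by (unfold t; now rewrite gassoc, ginv_r, gone_l).
  assert (K : edge_label y z (iota u t)) by (exists u, t, g; auto).
  rewrite (edge_label_unique _ _ _ _ Hq K).
  exists u, (gmul s t), g. split; [assumption|]. split.
  - now rewrite Ht, H2, gassoc.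
  - destruct Pgp as (Hh & _). symmetry. apply Hh.
Qed.

Lemma edge_label_parallel a b c d p : square a b c d -> edge_label a b p -> edge_label d c p.
Proof.
  intros S (u & s & g & H1 & H2 & ->). exists u, s, g.
  destruct (lam_same_side u g a b d c S H1) as (E1 & E2 & K). rewrite E1, E2. auto.
Qed.

(** The square itself witnesses that the orbits of its two consecutive sides are adjacent in the
    crossing graph. *)
Lemma edge_label_commute a b c d p q : square a b c d ->
  edge_label a b p -> edge_label a d q -> gmul p q = gmul q p.
Proof.
  intros S (u & s & g & H1 & H2 & ->) (v & t & h & H3 & H4 & ->).
  destruct Pgp as (_ & Hc & _). apply Hc.
  exists (gmul h (ginv g)).
  exists (act g b), (act g a), (act g d), (act g c).
  split; [now apply square_flip, (act_square Hact)|].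
  split; [apply hyp_sym; auto|].
  unfold pullback. now rewrite !(act_mul Hact), !(act_invK Hact).
Qed.

(** * The embedding and the retraction *)

Context (Hfin : finitely_many_vertex_orbits act).

Lemma embedding_exists (x0 : X) : exists j : G -> P,
  is_hom j /\ (forall g1 g2, j g1 = j g2 -> g1 = g2) /\
  virtual_retract (fun p => exists g, j g = p).
Proof.
  destruct right_action_exists as (ra & ra1 & raM & raG & raI).
  destruct (dependent_choice (fun xy p => adj (fst xy) (snd xy) ->
    edge_label (fst xy) (snd xy) p)) as [lab Hlab].
  { intros [x y]. destruct (classic (adj x y)) as [H|N].
    - destruct (edge_label_exists x y H) as [p Hp]. now exists p.
    - exists gone. contradiction. }
  assert (Hl : forall x y, adj x y -> edge_label x y (lab (x, y)))
    by (intros x y; apply (Hlab (x, y))).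
  destruct (potential_exists HX P (fun x y => lab (x, y)) x0) as (phi & phi0 & Hphi).
  { intros x y H. apply (edge_label_inv x y); auto using adj_sym. }
  { intros x y z H1 H2 H3. apply (edge_label_unique x z); auto.
    apply edge_label_triangle with (y := y); auto. }
  { intros a b c d S. pose proof S as (_ & _ & A1 & A2 & A3 & A4 & _).
    apply adj_sym in A3, A4.
    rewrite (edge_label_unique b c (lab (b, c)) (lab (a, d))); auto.
    - rewrite (edge_label_unique d c (lab (d, c)) (lab (a, b))); auto.
      + apply (edge_label_commute a b c d); auto.
      + apply (edge_label_parallel a b c d); auto.
    - apply (edge_label_parallel a d c b); auto. now apply square_transpose. }
  assert (lab_equiv : forall g x y, adj x y -> lab (act g x, act g y) = lab (x, y)).
  { intros g x y H. apply (edge_label_unique (act g x) (act g y)).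
    - apply Hl. now apply (act_adj Hact).
    - apply edge_label_equivariant; auto. }
  (* Labels are invariant under [G], so [phi] on a translated path differs from [phi] on the path by
     its value at the new base point. *)
  assert (phi_equiv : forall g x, phi (act g x) = gmul (phi (act g x0)) (phi x)).
  { intros g x. destruct (qm_connected HX x x0) as [n W].
    remember x0 as t eqn:Et in W.
    induction W as [x|x y z n Axy W IH]; subst.
    - now rewrite phi0, gone_r.
    - specialize (IH eq_refl). apply adj_sym in Axy.
      rewrite (Hphi y x Axy), gassoc, <- IH, <- (lab_equiv g y x Axy).
      apply Hphi. now apply (act_adj Hact). }
  (* Reading the labels of a path as moves walks along that path, so [phi x] carries [x0] to [x]. *)
  assert (ra_phi : forall x, ra x0 (phi x) = x).
  { intros x. destruct (qm_connected HX x x0) as [n W].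
    remember x0 as t eqn:Et in W.
    induction W as [x|x y z n Axy W IH]; subst.
    - now rewrite phi0.
    - specialize (IH eq_refl). apply adj_sym in Axy.
      rewrite (Hphi y x Axy), raM, IH.
      destruct (edge_label_move _ _ _ (Hl y x Axy)) as (u & s & M & ->).
      apply (move_unique u s y); auto. }
  assert (free : forall g h x, act g x = act h x -> g = h).
  { intros g h x E. apply (gcancel_l (ginv h)). rewrite ginv_l.
    apply (special_free Hact HX Hspec _ x).
    now rewrite (act_mul Hact), E, (act_invK Hact). }
  set (j g := phi (act g x0)).
  assert (raj : forall g, ra x0 (j g) = act g x0) by (intros; apply ra_phi).
  assert (jhom : is_hom j).
  { intros g h. unfold j. rewrite (act_mul Hact). apply phi_equiv. }
  assert (raV : forall p x y, ra x p = y -> ra y (ginv p) = x).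
  { intros p x y <-. now rewrite <- raM, ginv_r. }
  set (K p := exists g, ra x0 p = act g x0).
  (* On [K] the element [r p] is determined by freeness, and it defaults to [gone] elsewhere; the
     retraction is [j] after [r]. *)
  destruct (dependent_choice (fun p g => K p -> ra x0 p = act g x0)) as [r Hr].
  { intros p. destruct (classic (K p)) as [[g Hg]|N]; [now exists g|].
    exists gone. contradiction. }
  assert (KM : forall p q g h, ra x0 p = act g x0 -> ra x0 q = act h x0 ->
                 ra x0 (gmul p q) = act (gmul g h) x0).
  { intros p q g h Hg Hh. now rewrite raM, Hg, <- raG, Hh, (act_mul Hact). }
  exists j. split; [assumption|]. split.
  { intros g h E. apply (free g h x0). now rewrite <- !raj, E. }
  exists K, (fun p => j (r p)). repeat split.
  - exists gone. now rewrite ra1, (act_one Hact).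
  - intros p q [g Hg] [h Hh]. exists (gmul g h). now apply KM.
  - intros p [g Hg]. exists (ginv g). apply raV in Hg.
    rewrite <- raG in Hg. apply (act_inj Hact g). now rewrite Hg, (act_Kinv Hact).
  (* Elements [p] and [q] lie in the same left coset of [K] as soon as [ra x0 (ginv p)] and
     [ra x0 (ginv q)] lie in one [G]-orbit, so one [q] per orbit suffices. *)
  - destruct Hfin as [l Hl'].
    assert (L : exists reps : list P, forall w p g, In w l -> ra x0 (ginv p) = act g w ->
                  exists q h, In q reps /\ ra x0 (ginv q) = act h w).
    { clear Hl'. induction l as [|w l [reps IH]].
      - exists nil. contradiction.
      - destruct (classic (exists p g, ra x0 (ginv p) = act g w)) as [(p & g & E)|N].
        + exists (p :: reps)%list. intros w' p' g' [<-|Hw] E'.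
          * exists p, g. split; [left; reflexivity|assumption].
          * destruct (IH w' p' g' Hw E') as (q & h & Hq & Eq).
            exists q, h. split; [now right|assumption].
        + exists reps. intros w' p' g' [<-|Hw] E'; [exfalso|]; eauto. }
    destruct L as [reps L]. exists reps. intros p.
    destruct (Hl' (ra x0 (ginv p))) as (w & g & Hw & E).
    destruct (L w p g Hw E) as (q & h & Hq & Eq). exists q. split; [assumption|].
    exists (gmul h (ginv g)). apply raV in E. rewrite ginv_ginv in E.
    rewrite raM, Eq, (act_mul Hact). rewrite <- E.
    rewrite !raG. f_equal. now rewrite (act_invK Hact).
  - intros p [g <-]. exists g. apply raj.
  - intros p _. now exists (r p).
  - intros p q [g Hg] [h Hh]. rewrite <- jhom. f_equal.
    apply (free _ _ x0). rewrite <- Hr by (exists (gmul g h); now apply KM).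
    symmetry. rewrite <- (KM p q (r p) (r q)); [reflexivity| |].
    + apply Hr. now exists g.
    + apply Hr. now exists h.
  - intros p [g <-]. f_equal. apply (free _ _ x0). rewrite <- Hr; [apply raj|].
    exists g. apply raj.
Qed.
End HyperplaneOrbits.

Theorem theorem1p1 (G : Group) (X : SGraph) (act : G -> X -> X)
  (Hact : is_action act) (HX : quasi_median X) (Hspec : special_action act)
  (Hfin : finitely_many_vertex_orbits act) :
  exists (Gam : SGraph) (Gs : Gam -> Group) (P : Group)
         (iota : forall u : Gam, Gs u -> P),
    (forall u, nontrivial_group (Gs u)) /\
    is_graph_product Gs P iota /\
    (forall u : Gam, exists (C : X -> Prop) (H : Gs u -> Prop),
        is_clique C /\ is_subgroup H /\ finite_index H /\
        subgroups_isomorphic H (stab_set act C)) /\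
    exists j : G -> P,
      is_hom j /\ (forall g1 g2, j g1 = j g2 -> g1 = g2) /\
      virtual_retract (fun p => exists g, j g = p).
Proof.
  destruct (hyperplane_orbits_exist Hact) as (Q & Jr & HJr & Jr_orbit & Jr_all).
  destruct (dependent_choice _ (fun u => sector_group_exists Hact HX Hspec Hfin (Jr u) (HJr u)))
    as [A HA].
  apply dependent_choice in HA as [lam Hlam].
  set (Gam := crossing_graph Hact HX Hspec HJr).
  destruct (graph_product_exists Gam A) as (P & iota & Pgp).
  exists Gam, A, P, iota.
  split; [intros u; apply Hlam|]. split; [assumption|]. split; [intros u; apply Hlam|].
  destruct (classic (exists x0 : X, True)) as [[x0 _]|N].
  - apply (embedding_exists Hact HX Hspec HJr Jr_orbit (lam := lam)) with (iota := iota); auto;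
      intros u; apply Hlam.
  (* The graph [X] is empty: faithfulness makes [G] trivial, there are no hyperplanes, and [P] is
     trivial by the uniqueness part of its universal property. *)
  - assert (trivial : forall g h : G, g = h).
    { assert (K : forall g : G, g = gone).
      { intros g. apply Hspec. intros x. exfalso. eauto. }
      intros g h. now rewrite (K g), (K h). }
    assert (NQ : forall u : Q, False).
    { intros u. destruct (HJr u) as [[[a b] _] _]. eauto. }
    assert (trivialP : forall p : P, p = gone).
    { destruct Pgp as (_ & _ & univ).
      destruct (univ P (fun _ _ => gone)) as [_ U];
        [intros u; destruct (NQ u)|intros u; destruct (NQ u)|].
      apply (U (fun p => p) (fun _ => gone)); [intros p q; reflexivity| | |];
        [intros p q; now rewrite gone_l|intros u; destruct (NQ u)|reflexivity]. }
    assert (jhom : is_hom (fun _ : G => @gone P)) by (intros g h; now rewrite gone_l).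
    exists (fun _ => gone). split; [assumption|]. split; [auto|].
    exists (fun _ => True), (fun p => p).
    split; [repeat split|]. split; [|split; [|split; [|split]]]; auto.
    + exists (@gone P :: nil)%list. intros p. exists gone. split; [left|]; auto.
    + intros p _. exists gone. symmetry. apply trivialP.
Qed.
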